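(* Let $d\ge2$, let $J=[a,b]\subset(2,\infty)$ and put $$\beta=\min\{1,a-2\},\qquad C_J=b(b-1)\bigl(\max\{1,b-2\}+2\bigr)+b^2.$$ Suppose $p\in J$, $\mu\in\mathcal M_p$, and $\operatorname{Hess}F_{p,\mu}(x)\succeq h\,\mathrm{Id}$ for all $x\in\operatorname{supp}\mu$, where $h>0$. Set $$r=\min\left\{1,\left(\frac{h}{2C_J}\right)^{1/\beta}\right\}.$$ Then distinct points of $\operatorname{supp}\mu$ have spherical (geodesic) distance greater than $r$, and $$\#\operatorname{supp}\mu\le\left(1+\frac\pi r\right)^d.$$ If $d=3$ (that is, on $\mathbb S^2$), one also has $\#\operatorname{supp}\mu\le\dfrac{2}{1-\cos(r/2)}$.
   Context: $\mathbb S^{d-1}$ is the real unit sphere in $\mathbb R^d$. For $p>0$, $\mathcal M_p$ is the set of Borel probability measures on $\mathbb S^{d-1}$ minimizing $I_p(\mu)=\iint|x\cdot y|^p\,d\mu(x)\,d\mu(y)$ among all Borel probability measures on $\mathbb S^{d-1}$. The potential is $F_{p,\mu}(x)=\int|x\cdot y|^p\,d\mu(y)$, which for $p>2$ is $C^2$ on $\mathbb S^{d-1}$. $\operatorname{Hess}F(x)$ is the Riemannian Hessian on the round sphere, a quadratic form on $x^\perp$; for unit $v\perp x$, $\operatorname{Hess}F(x)[v,v]=\frac{d^2}{ds^2}\big|_{s=0}F(x\cos s+v\sin s)$. $\operatorname{Hess}F(x)\succeq h\,\mathrm{Id}$ means $\operatorname{Hess}F(x)[v,v]\ge h$ for all unit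 $v\perp x$. Supports are counted as subsets of the sphere. *)

(* Defs.v *)
From HB Require Import structures.
From mathcomp Require Import all_boot all_order all_algebra.
From mathcomp Require Import all_classical all_reals all_analysis.
Import Order.TTheory GRing.Theory Num.Theory.
Import numFieldNormedType.Exports.

Set Implicit Arguments.
Unset Strict Implicit.
Unset Printing Implicit Defensive.

Local Open Scope classical_set_scope.
Local Open Scope ring_scope.

(* The library norm on matrices is the sup norm, so Euclidean notions are
   expressed through this inner product. *)
Definition dot (R : realType) (m : nat) (x y : 'rV[R]_m) : R :=
  \sum_(i < m) x 0 i * y 0 i.

(* [sphere R n] is S^n, a subset of R^(n+1).  The library requires measurable
   types to be pointed, which the dimension n.+1 guarantees. *)
Definition sphere (R : realType) (n : nat) : Type :=
  set_type [set x : 'rV[R]_n.+1 | dot x x = 1].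

Definition sphere_vec (R : realType) (n : nat) (x : sphere R n) :
  'rV[R]_n.+1 := set_val x.

Section SphereStructures.
Variables (R : realType) (n : nat).

HB.instance Definition _ := PseudoMetric.copy (sphere R n)
  (set_type [set x : 'rV[R]_n.+1 | dot x x = 1]).

Lemma delta_mx_on_sphere :
  (delta_mx 0 0 : 'rV[R]_n.+1) \in [set x : 'rV[R]_n.+1 | dot x x = 1].
Proof.
rewrite inE /= /dot big_ord_recl big1 ?addr0; last first.
  by move=> i _; rewrite mxE /= mul0r.
by rewrite mxE !eqxx mulr1.
Qed.

HB.instance Definition _ := isPointed.Build (sphere R n)
  (exist _ (delta_mx 0 0) delta_mx_on_sphere).

HB.instance Definition _ := @isMeasurable.Build
  (sigma_display (@open (sphere R n))) (sphere R n) <<s @open (sphere R n) >>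
  (@sigma_algebra0 _ setT _) (@sigma_algebraC _ _)
  (@sigma_algebra_bigcup _ setT _).

End SphereStructures.

Section Energy.
Variables (R : realType) (n : nat).
Implicit Types (p : R) (mu : probability (sphere R n) R).

Definition energy p mu : \bar R :=
  (\int[mu]_x \int[mu]_y (`|dot (sphere_vec x) (sphere_vec y)| `^ p)%:E)%E.

Definition minimizers p : set (probability (sphere R n) R) :=
  [set mu | forall nu : probability (sphere R n) R,
              (energy p mu <= energy p nu)%E].

(* Defined by the same formula on all of R^(n+1); only its restriction to the
   sphere matters below. *)
Definition potential p mu (x : 'rV[R]_n.+1) : R :=
  \int[mu]_y (`|dot x (sphere_vec y)| `^ p).

Definition supp mu : set (sphere R n) :=
  [set x | forall U : set (sphere R n), open U -> U x -> (0 < mu U)%E].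

(* [v] is meant to be a unit vector orthogonal to [x]; the curve is then the
   unit-speed geodesic of the sphere starting at [x] with velocity [v]. *)
Definition sphere_hess (F : 'rV[R]_n.+1 -> R) (x : sphere R n)
    (v : 'rV[R]_n.+1) : R :=
  derive1n 2 (fun s : R => F (cos s *: sphere_vec x + sin s *: v)) 0.

Definition sphere_hess_ge (F : 'rV[R]_n.+1 -> R) (x : sphere R n) (h : R) :
    Prop :=
  forall v : 'rV[R]_n.+1, dot v v = 1 -> dot (sphere_vec x) v = 0 ->
    h <= sphere_hess F x v.

Definition sphere_dist (x y : sphere R n) : R :=
  acos (dot (sphere_vec x) (sphere_vec y)).

End Energy.

(* Main.v *)
(* Let F be the potential of mu and I its energy. Perturbing mu towards a point
   mass shows F >= I everywhere on the sphere, with equality on supp mu. Along a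
   unit-speed geodesic issued from a support point, g(s) = F has g'(0) = 0 and
   g''(0) >= h, while |g''(s) - g''(0)| <= C_J s ^ beta; hence g'' >= h / 2 on
   [0, r] and g > I on (0, r], so no other support point lies within r.

   Counting in dimension d uses no volume: 2-separated points y_i of norm at most
   kappa - 1, with kappa = 1 + pi / r, can be nested k times, and the N ^ k
   points so obtained sit 2-separated in a ball of radius kappa ^ k, which a grid
   bounds by a constant times kappa ^ (k d).

   On the 2-sphere the area of a cap is replaced by a mean over points, exact on
   polynomials in x . c: with u the normalized height and z the longitude of x,
   (1 - x . c) / 2 is a squared modulus |P + Q z| ^ 2, and the mean of its k-th
   power is 1 / (k + 1) whatever c. Applying this to polynomials approximating
   the indicator of a cap bounds the number of disjoint caps. *)
From HB Require Import structures.
Require Import Defs.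
From mathcomp Require cyclic separable cyclotomic complex polyrcf.
From mathcomp Require Import all_boot all_order all_algebra.
From mathcomp Require Import finmap.
From mathcomp Require Import all_classical all_reals all_analysis.
From mathcomp Require Import measurable_realfun lebesgue_integral_under.
From mathcomp Require Import ring lra.
Import Order.TTheory GRing.Theory Num.Theory.
Import numFieldNormedType.Exports.
Local Open Scope classical_set_scope.
Local Open Scope ring_scope.

Set Implicit Arguments.
Unset Strict Implicit.
Unset Printing Implicit Defensive.

(** * Euclidean packing *)

Section Dot.
Context {R : realType} {n : nat}.
Implicit Types x y z : 'rV[R]_n.

Lemma dotC x y : dot x y = dot y x.
Proof. by apply: eq_bigr => i _; rewrite mulrC. Qed.

Lemma dotDl x y z : dot (x + y) z = dot x z + dot y z.
Proof. by rewrite -big_split; apply: eq_bigr => i _; rewrite mxE mulrDl. Qed.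

Lemma dotDr x y z : dot z (x + y) = dot z x + dot z y.
Proof. by rewrite dotC dotDl !(dotC z). Qed.

Lemma dotZl a x y : dot (a *: x) y = a * dot x y.
Proof. by rewrite mulr_sumr; apply: eq_bigr => i _; rewrite mxE mulrA. Qed.

Lemma dotZr a x y : dot x (a *: y) = a * dot x y.
Proof. by rewrite dotC dotZl dotC. Qed.

Lemma dotBl x y z : dot (x - y) z = dot x z - dot y z.
Proof. by rewrite dotDl -scaleN1r dotZl mulN1r. Qed.

Lemma dotBr x y z : dot z (x - y) = dot z x - dot z y.
Proof. by rewrite !(dotC z) dotBl. Qed.

Lemma dot_ge0 x : 0 <= dot x x.
Proof. by apply: sumr_ge0 => i _; rewrite -expr2 sqr_ge0. Qed.

Lemma dot_eq0 x : dot x x = 0 -> x = 0.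
Proof.
move=> /psumr_eq0P x0; apply/rowP => i; rewrite mxE.
by apply/eqP; rewrite -sqrf_eq0 expr2 x0 // => j _; rewrite -expr2 sqr_ge0.
Qed.

Lemma cauchy_schwarz x y : dot x y ^+ 2 <= dot x x * dot y y.
Proof.
have [y0|y0] := eqVneq (dot y y) 0.
  by rewrite (dot_eq0 y0) -(scale0r y) !dotZr !(mul0r, mulr0) expr0n.
have yp : 0 < dot y y by rewrite lt_def y0 dot_ge0.
(* The squared norm of this vector is [dot y y] times the gap in the inequality. *)
have := dot_ge0 (dot y y *: x - dot x y *: y).
rewrite dotBl !dotBr !dotZl !dotZr (dotC y x) => h.
rewrite -subr_ge0 -(pmulr_rge0 _ yp); nra.
Qed.

Definition enorm x := Num.sqrt (dot x x).

Lemma enorm_ge0 x : 0 <= enorm x. Proof. exact: sqrtr_ge0. Qed.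

Lemma enorm_sq x : enorm x ^+ 2 = dot x x.
Proof. by rewrite sqr_sqrtr// dot_ge0. Qed.

Lemma dot_le_enorm x y : dot x y <= enorm x * enorm y.
Proof.
apply: (le_trans (ler_norm _)).
rewrite -sqrtrM ?dot_ge0// -sqrtr_sqr ler_sqrt ?mulr_ge0 ?dot_ge0//.
exact: cauchy_schwarz.
Qed.

Lemma enormD x y : enorm (x + y) <= enorm x + enorm y.
Proof.
have := enorm_ge0 (x + y); have := enorm_ge0 x; have := enorm_ge0 y.
have := enorm_sq (x + y); have := enorm_sq x; have := enorm_sq y.
have := dot_le_enorm x y.
rewrite dotDl !dotDr (dotC y x); nra.
Qed.

Lemma enormN x : enorm (- x) = enorm x.
Proof. by rewrite /enorm -scaleN1r dotZl dotZr; congr Num.sqrt; ring. Qed.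

Lemma enormZ a x : 0 <= a -> enorm (a *: x) = a * enorm x.
Proof.
move=> a0; rewrite /enorm dotZl dotZr mulrA -expr2.
by rewrite sqrtrM ?sqr_ge0// sqrtr_sqr ger0_norm.
Qed.

Lemma coord_le_enorm x i : `|x 0 i| <= enorm x.
Proof.
rewrite -sqrtr_sqr ler_sqrt ?dot_ge0// /dot (bigD1 i)//= -expr2 lerDl.
by apply: sumr_ge0 => j _; rewrite -expr2 sqr_ge0.
Qed.

End Dot.

(** If [a > b], Bernoulli makes [(a / b) ^ k] grow at least linearly in [k], past any [C]. This is
    how a constant factor is lost when [k]-th roots are taken. *)
Lemma pow_le_const_mul_pow {R : realType} (a b C : R) :
  0 <= a -> 0 < b -> (forall k, a ^+ k <= C * b ^+ k) -> a <= b.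
Proof.
move=> a0 b0 hC; rewrite leNgt; apply/negP => ba.
pose e := a / b - 1.
have e0 : 0 < e by rewrite subr_gt0 ltr_pdivlMr// mul1r.
have bern k : 1 + e *+ k <= (1 + e) ^+ k.
  elim: k => [|k IH]; first by rewrite mulr0n addr0 expr0.
  have ek : 0 <= e *+ k by rewrite mulrn_wge0// ltW.
  rewrite exprS mulrS; nra.
have le k : e *+ k <= C.
  have h : (1 + e) ^+ k <= C.
    by rewrite /e addrC subrK expr_div_n ler_pdivrMr ?exprn_gt0.
  by have := bern k; lra.
have := le (Num.truncn (C / e)).+1.
have := truncnS_gt (C / e); rewrite ltr_pdivrMr// mulrC mulr_natr.
by move=> h1 h2; have := lt_le_trans h1 h2; rewrite ltxx.
Qed.

(* Tensor power trick in place of a volume comparison: nesting rescaled copies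
   of the configuration puts [N ^ k] separated points into a ball of radius
   [kappa ^ k], and a grid shows that such a ball holds at most
   [C * kappa ^ (k * n)] of them. *)
Section Packing.
Context {R : realType} {n N : nat} (kappa : R) (y : 'I_N -> 'rV[R]_n).
Hypothesis kappa1 : 1 < kappa.
Hypothesis y_bound : forall i, enorm (y i) <= kappa - 1.
Hypothesis y_sep : forall i j, i != j -> 2 <= enorm (y i - y j).

(** Level [k + 1] places a copy of level [k] around each [kappa ^ k y_i]; norms add up to [kappa ^ k
    - 1 + kappa ^ k (kappa - 1) = kappa ^ (k + 1) - 1]. *)
Lemma nested_packing k : exists (W : finType) (f : W -> 'rV[R]_n),
  [/\ #|W| = (N ^ k)%N, forall w, enorm (f w) <= kappa ^+ k - 1 &
      forall w w', w != w' -> 2 <= enorm (f w - f w')].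
Proof.
have kp j : 1 <= kappa ^+ j by rewrite exprn_ege1// ltW.
elim: k => [|k [W [f [cW fb fs]]]].
  exists unit, (fun=> 0); split; first by rewrite card_unit expn0.
    by move=> _; rewrite /enorm -(scale0r 0) dotZl mul0r sqrtr0 expr0 subrr.
  by move=> [] [].
have kk : 0 <= kappa ^+ k by rewrite (le_trans _ (kp k)).
exists (W * 'I_N)%type, (fun w => f w.1 + kappa ^+ k *: y w.2); split.
- by rewrite card_prod cW card_ord expnSr.
- move=> [w i] /=; apply: (le_trans (enormD _ _)); rewrite enormZ//.
  by have := fb w; have := y_bound i; rewrite exprSr; nra.
- move=> [w i] [w' i'] neq /=.
  have [ii|ii] := eqVneq i i'.
    rewrite ii opprD addrACA subrr addr0; apply: fs.
    by apply: contraNneq neq => ->; rewrite ii.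
  (* Distinct centres are at least [2 kappa ^ k] apart, and the two inner vectors take away at most
     [2 (kappa ^ k - 1)], which leaves 2. *)
  have : enorm (kappa ^+ k *: (y i - y i')) <=
     enorm (f w + kappa ^+ k *: y i - (f w' + kappa ^+ k *: y i'))
       + (enorm (f w') + enorm (- f w)).
    rewrite -[X in enorm X <= _](_ : (f w + kappa ^+ k *: y i -
      (f w' + kappa ^+ k *: y i')) + (f w' + - f w) = _); last first.
      rewrite scalerBr; apply/rowP => j; rewrite !mxE; ring.
    by apply: (le_trans (enormD _ _)); rewrite lerD2l enormD.
  rewrite enormZ// enormN.
  by have := y_sep ii; have := fb w; have := fb w'; nra.
Qed.

Lemma grid_bound (W : finType) (f : W -> 'rV[R]_n) (K : R) : 1 <= K ->
  (forall w, enorm (f w) <= K) ->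
  (forall w w', w != w' -> 2 <= enorm (f w - f w')) ->
  #|W|%:R <= (((2 * n.+1).+1)%:R * K) ^+ n.
Proof.
move=> K1 fb fs.
(* Grid cells have side [1 / m]: two points in one cell are at squared distance at most
   [n / m <= 1], below the required 4. *)
pose m : R := n.+1%:R.
have m1 : 1 <= m by rewrite /m ler1n.
pose B := (Num.truncn (2 * K * m)).+1.
have coord_ge0 w (j : 'I_n) : 0 <= (f w 0 j + K) * m.
  have := le_trans (coord_le_enorm (f w) j) (fb w).
  by rewrite ler_norml => /andP[? ?]; apply: mulr_ge0; lra.
have lt_B w (j : 'I_n) : (Num.truncn ((f w 0 j + K) * m)%R < B)%N.
  rewrite ltnS; apply: le_truncn; apply: ler_wpM2r; first lra.
  have := le_trans (coord_le_enorm (f w) j) (fb w).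
  by rewrite ler_norml => /andP[? ?]; lra.
pose g w : {ffun 'I_n -> 'I_B} := [ffun j => Ordinal (lt_B w j)].
have g_inj : injective g.
  move=> w w' gww; apply/eqP/negPn/negP => /fs.
  apply/negP; rewrite -ltNge.
  have close (j : 'I_n) : `|f w 0 j - f w' 0 j| * m <= 1.
    have := congr1 (fun h : {ffun _ -> _} => nat_of_ord (h j)) gww.
    rewrite !ffunE /= => e.
    have /andP[a1 a2] := truncn_itv (coord_ge0 w j).
    have /andP[b1 b2] := truncn_itv (coord_ge0 w' j).
    rewrite e in a1 a2; rewrite -natr1 in a2; rewrite -natr1 in b2.
    rewrite -[m]ger0_norm; last lra.
    by rewrite -normrM ler_norml; apply/andP; split; lra.
  have nm : n%:R <= m by rewrite /m ler_nat.
  suff : dot (f w - f w') (f w - f w') <= 1.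
    by rewrite -enorm_sq => ?; have := enorm_ge0 (f w - f w'); nra.
  apply: (@le_trans _ _ (\sum_(j < n) m^-1)).
    apply: ler_sum => j _; rewrite !mxE -expr2 -real_normK ?num_real//.
    have := close j; rewrite -ler_pdivlMr; last lra.
    have mi : m^-1 <= 1 by rewrite invf_le1; lra.
    have mi0 : 0 < m^-1 by rewrite invr_gt0; lra.
    rewrite mul1r => le_mi; apply: (@le_trans _ _ (m^-1 ^+ 2)).
      by rewrite ler_sqr ?nnegrE // ltW.
    by rewrite expr2 ler_piMl // ltW.
  rewrite sumr_const card_ord -mulr_natl ler_pdivrMr; lra.
have := leq_card g g_inj.
rewrite card_ffun !card_ord => cW.
apply: (@le_trans _ _ ((B ^ n)%N%:R)); first by rewrite ler_nat.
rewrite natrX; apply: lerXn2r; rewrite ?nnegrE ?mulr_ge0//; first lra.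
have h : (Num.truncn (2 * K * m))%:R <= 2 * K * m by rewrite truncn_le// !mulr_ge0//; lra.
have -> : (2 * n.+1).+1%:R = 2 * m + 1 :> R by rewrite -natr1 natrM.
by rewrite /B -natr1; nra.
Qed.

(** The grid constant [(2 n + 3) ^ n] does not depend on [k], so it disappears from
    [N ^ k <= C (kappa ^ n) ^ k]. *)
Lemma packing_bound : N%:R <= kappa ^+ n.
Proof.
apply: (@pow_le_const_mul_pow _ _ _ ((((2 * n.+1).+1)%:R) ^+ n)) => //.
  by rewrite exprn_gt0// (lt_trans ltr01).
move=> k; have [W [f [cW fb fs]]] := nested_packing k.
rewrite -[N%:R ^+ k]natrX -cW exprAC -exprMn; apply: (grid_bound (f := f)) => //.
  by rewrite exprn_ege1// ltW.
by move=> w; have := fb w; lra.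
Qed.

End Packing.

(** * Powers of the absolute value along great circles *)

Section AbsPow.
Context {R : realType}.
Implicit Types q t u v : R.

Lemma continuous_abspow0 q : 0 < q -> {for 0, continuous (fun t => `|t| `^ q)}.
Proof.
move=> q0; rewrite /prop_for /continuous_at normr0 powR0 ?gt_eqF//.
apply/cvgrPdist_lt => e e0; near=> z.
rewrite sub0r normrN ger0_norm ?powR_ge0//.
have -> : e = (e `^ q^-1) `^ q by rewrite -powRrM mulVf ?gt_eqF// powRr1// ltW.
apply: gt0_ltr_powR; rewrite ?nnegrE ?powR_ge0//.
near: z; apply/nbhs_ballP; exists (e `^ q^-1); first exact: powR_gt0.
by move=> w; rewrite /ball /= sub0r normrN.
Unshelve. all: by end_near. Qed.

(** This odd power function is differentiable at 0 too. With [q = p - 2] it carries both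
    differentiations of [|t| ^ p]. *)
Lemma is_derive_mul_abspow q t : 0 < q ->
  is_derive t 1 (fun t => t * `|t| `^ q) ((q + 1) * `|t| `^ q).
Proof.
move=> q0.
have pos (s : R) : 0 < s -> is_derive s 1 (fun t => t * `|t| `^ q) ((q + 1) * `|s| `^ q).
  move=> s0; apply: (@near_eq_is_derive _ _ _ (@powR R ^~ (q + 1))).
    near=> z; have z0 : 0 < z by near: z; exact: lt_nbhsr.
    by rewrite gtr0_norm// -[X in _ = z * z `^ X](addrK 1 q) mulr_powRB1 ?ltW// addr_gt0.
  by rewrite gtr0_norm//; apply: (is_derive_eq (is_derive1_powR (q + 1) s0)); rewrite addrK.
have [t0|t0|->] := ltgtP t 0; last 1 first.
(* At 0 the difference quotient is [|z| ^ q], continuous there with value 0. *)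
- apply/is_derive1_caratheodory; exists (fun z => `|z| `^ q); split.
  + by move=> z; rewrite mul0r !subr0 mulrC.
  + exact: continuous_abspow0.
  + by rewrite normr0 powR0 ?gt_eqF// mulr0.
- have := pos (- t); rewrite oppr_gt0 => /(_ t0) dpos.
  have -> : (fun t => t * `|t| `^ q) = - ((fun t => t * `|t| `^ q) \o (-%R : R -> R)).
    by apply/funext => s; rewrite fctE /= normrN mulNr opprK.
  by apply: is_derive_eq; rewrite mulrN1 opprK normrN.
- exact: pos.
Unshelve. all: by end_near. Qed.

Lemma abspowE q t : 2 < q -> `|t| `^ q = t * (t * `|t| `^ (q - 2)).
Proof.
move=> q2; rewrite mulrA -expr2 -real_normK ?num_real// expr2 -mulrA.
have -> : q - 2 = q - 1 - 1 by ring.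
by rewrite !mulr_powRB1// ?subr_gt0; lra.
Qed.

Lemma is_derive_abspow q t : 2 < q ->
  is_derive t 1 (fun t => `|t| `^ q) (q * (t * `|t| `^ (q - 2))).
Proof.
move=> q2.
have dm : is_derive t 1 (fun t => t * `|t| `^ (q - 2)) ((q - 2 + 1) * `|t| `^ (q - 2)).
  by apply: is_derive_mul_abspow; rewrite subr_gt0.
have -> : (fun t => `|t| `^ q) = id * (fun t => t * `|t| `^ (q - 2)).
  by apply/funext => s; rewrite abspowE.
apply: is_derive_eq; rewrite /= !/GRing.scale /=; ring.
Qed.

End AbsPow.

(** * Hölder continuity of powers on the unit interval *)

Section Hoelder.
Context {R : realType}.
Implicit Types q t u v : R.

Lemma powR_le1 q u : 0 <= q -> 0 <= u <= 1 -> u `^ q <= 1.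
Proof.
move=> q0 /andP[u0 u1].
have := ge0_ler_powR q0 (_ : u \in Num.nneg) (_ : 1 \in Num.nneg) u1.
by rewrite !nnegrE powR1; apply.
Qed.

(** For [q <= 1] the power lies above its chord on [[0, u]]; adding the chord bounds at [v] and
    [u - v] gives subadditivity. For [q > 1] the mean value theorem applies, the derivative being at
    most [q] on [[0, 1]]. *)
Lemma powR_sub_le q u v : 0 < q -> 0 <= v -> v <= u -> u <= 1 ->
  u `^ q - v `^ q <= Num.max 1 q * (u - v) `^ Num.min 1 q.
Proof.
move=> q0 v0 vu u1; have [q1|q1] := leP q 1.
  rewrite mul1r.
  have [uv|uv] := eqVneq u v; first by rewrite uv !subrr powR_ge0.
  have u0 : 0 < u by apply: (le_lt_trans v0); rewrite lt_def uv.
  have key x : 0 <= x <= u -> x / u * u `^ q <= x `^ q.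
    move=> /andP[x0 xu].
    have [->|xN0] := eqVneq x 0; first by rewrite !mul0r powR_ge0.
    have -> : x `^ q = (x / u) `^ q * u `^ q.
      by rewrite -powRM ?(ltW u0) ?divr_ge0 ?(ltW u0)// divfK ?gt_eqF.
    rewrite ler_wpM2r ?powR_ge0// ger1_powR//.
    rewrite divr_gt0 ?ler_pdivrMr ?mul1r//=.
    by rewrite lt_def xN0.
  have h1 := key v; rewrite v0 vu in h1; have {}h1 := h1 isT.
  have h2 := key (u - v); rewrite subr_ge0 vu gerBl v0 in h2; have {}h2 := h2 isT.
  have : v / u * u `^ q + (u - v) / u * u `^ q = u `^ q.
    by field; rewrite gt_eqF.
  lra.
have [<-|uv] := eqVneq v u; first by rewrite !subrr powR0 ?oner_eq0// mulr0.
have vu' : v < u by rewrite lt_def eq_sym uv.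
rewrite powRr1 ?subr_ge0//.
have [->|vN0] := eqVneq v 0.
  rewrite powR0 ?gt_eqF// !subr0; apply: (@le_trans _ _ u).
    by rewrite ge1r_powR ?(ltW q1)// u1 andbT (le_lt_trans v0).
  by rewrite ler_peMl ?(ltW q1)// (le_trans v0).
have d x : x \in `[v, u]%R -> is_derive x 1 (@powR R ^~ q) (q * x `^ (q - 1)).
  move=> /itvP x_in; apply: is_derive1_powR.
  by apply: (@lt_le_trans _ _ v); rewrite ?x_in// lt_def vN0.
have cont : {within `[v, u], continuous (@powR R ^~ q : R -> R)}.
  by apply: derivable_within_continuous => x /d [].
have d' x : x \in `]v, u[%R -> is_derive x 1 (@powR R ^~ q) (q * x `^ (q - 1)).
  by move=> /subset_itv_oo_cc; exact: d.
have [c /itvP c_in ->] := MVT vu' d' cont.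
rewrite ler_wpM2r ?subr_ge0// ler_piMr ?(ltW q0)//.
have c0 : 0 <= c by apply: (le_trans v0); rewrite c_in.
have c1 : c <= 1 by apply: le_trans u1; rewrite c_in.
by apply: powR_le1; rewrite ?c0 ?subr_ge0// ltW.
Qed.

Lemma abspow_hoelder q u v : 0 < q -> `|u| <= 1 -> `|v| <= 1 ->
  `| `|u| `^ q - `|v| `^ q| <= Num.max 1 q * `|u - v| `^ Num.min 1 q.
Proof.
move=> q0; wlog vu : u v / `|v| <= `|u| => [th|u1 v1].
  have [/th//|/ltW uv] := leP `|v| `|u|.
  by move=> u1 v1; rewrite distrC (distrC u v) th.
rewrite ger0_norm; last first.
  by rewrite subr_ge0 ge0_ler_powR ?nnegrE// ltW.
apply: (le_trans (powR_sub_le q0 (normr_ge0 v) vu u1)).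
rewrite ler_wpM2l// ?le_max ?ler01//.
by rewrite ge0_ler_powR ?nnegrE ?subr_ge0 ?le_min ?ler01 ?(ltW q0)// lerB_dist.
Qed.

End Hoelder.

(** At [p = b] this is the constant [C_J]. As a function of the exponent it serves the estimate at
    the actual [p]; monotonicity then passes to [b]. *)
Definition hoelder_const {R : realType} (p : R) : R :=
  p * (p - 1) * (Num.max 1 (p - 2) + 2) + p ^+ 2.

(* [al] and [be] stand for [x . y] and [v . y], so that [circ s] is the product of
   [y] with the point [cos s x + sin s v] of a geodesic. *)
Section GreatCircle.
Context {R : realType} (p al be : R).
Hypothesis p2 : 2 < p.
Hypothesis unit_le : al ^+ 2 + be ^+ 2 <= 1.
Implicit Types s t : R.

Definition circ s := cos s * al + sin s * be.
Definition circ' s := cos s * be - sin s * al.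

(** [kern1] and [kern2] are the first two derivatives of [kern]; the last term of [kern2] comes from
    [circ'' = - circ]. *)
Definition kern s := `|circ s| `^ p.
Definition kern1 s := p * (circ s * `|circ s| `^ (p - 2)) * circ' s.
Definition kern2 s :=
  p * (p - 1) * (`|circ s| `^ (p - 2) * circ' s ^+ 2) - p * `|circ s| `^ p.

(** The pair [(circ s, circ' s)] is a rotation of [(al, be)]; hence both entries stay in [[-1, 1]]
    and are 1-Lipschitz. *)
Lemma circ_sq s : circ s ^+ 2 + circ' s ^+ 2 = al ^+ 2 + be ^+ 2.
Proof.
transitivity ((cos s ^+ 2 + sin s ^+ 2) * (al ^+ 2 + be ^+ 2)).
  by rewrite /circ /circ'; ring.
by rewrite cos2Dsin2 mul1r.
Qed.

Lemma circ_le1 s : `|circ s| <= 1.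
Proof.
have h : circ s ^+ 2 <= 1.
  by rewrite (le_trans _ unit_le)// -(circ_sq s) lerDl sqr_ge0.
by rewrite -(@expr_le1 _ 2)// real_normK ?num_real.
Qed.

Lemma circ'_le1 s : `|circ' s| <= 1.
Proof.
have h : circ' s ^+ 2 <= 1.
  by rewrite (le_trans _ unit_le)// -(circ_sq s) lerDr sqr_ge0.
by rewrite -(@expr_le1 _ 2)// real_normK ?num_real.
Qed.

Lemma abspow_le1 q (u : R) : 0 <= q -> `|u| <= 1 -> 0 <= `|u| `^ q <= 1.
Proof.
move=> q0 u1; rewrite powR_ge0/=.
by apply: powR_le1; rewrite // normr_ge0.
Qed.

Lemma is_derive_circ s : is_derive s 1 circ (circ' s).
Proof.
have -> : circ = al \*: (@cos R) + be \*: (@sin R).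
  by apply/funext => t; congr (_ + _); exact: mulrC.
by apply: is_derive_eq; rewrite /circ' -![_ *: _]/(_ * _); ring.
Qed.

Lemma is_derive_circ' s : is_derive s 1 circ' (- circ s).
Proof.
have -> : circ' = be \*: (@cos R) - al \*: (@sin R).
  by apply/funext => t; congr (_ - _); exact: mulrC.
by apply: is_derive_eq; rewrite /circ -![_ *: _]/(_ * _); ring.
Qed.

Lemma is_derive_kern s : is_derive s 1 kern (kern1 s).
Proof.
have dc := is_derive_circ s.
have da := is_derive_abspow (circ s) p2.
exact: (@is_derive1_comp _ (fun t => `|t| `^ p) circ _ _ _ da dc).
Qed.

Lemma is_derive_kern1 s : is_derive s 1 kern1 (kern2 s).
Proof.
have dc := is_derive_circ s; have dc' := is_derive_circ' s.
have p20 : 0 < p - 2 by rewrite subr_gt0.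
have da := is_derive_mul_abspow (circ s) p20.
have dcomp := @is_derive1_comp _ (fun t => t * `|t| `^ (p - 2)) circ _ _ _ da dc.
have -> : kern1 = p \*: (((fun t => t * `|t| `^ (p - 2)) \o circ) * circ').
  by apply/funext => t; rewrite /kern1 -mulrA.
apply: is_derive_eq; rewrite /kern2 (abspowE _ p2) /= -![_ *: _]/(_ * _).
ring.
Qed.

Lemma kern1_le s : `|kern1 s| <= p.
Proof.
have p0 : 0 <= p by have := p2; lra.
rewrite /kern1 !normrM (ger0_norm (powR_ge0 _ _)) (ger0_norm p0).
have q0 : 0 <= p - 2 by have := p2; lra.
have /andP[a0 a1] := abspow_le1 q0 (circ_le1 s).
have := circ_le1 s; have := circ'_le1 s.
have := normr_ge0 (circ s); have := normr_ge0 (circ' s) => ? ? ? ?.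
by rewrite -mulrA ler_piMr ?mulr_ile1 ?mulr_ge0//.
Qed.

Lemma kern2_le s : `|kern2 s| <= p * (p - 1) + p.
Proof.
have q0 : 0 <= p - 2 by have := p2; lra.
have /andP[a0 a1] := abspow_le1 q0 (circ_le1 s).
have p0 : 0 <= p by have := p2; lra.
have /andP[b0 b1] := abspow_le1 p0 (circ_le1 s).
apply: (le_trans (ler_normB _ _)); rewrite !normrM.
have p1 : 0 <= p - 1 by have := p2; lra.
rewrite (ger0_norm p0) (ger0_norm b0) (ger0_norm a0) (ger0_norm p1).
apply: lerD; apply: ler_piMr => //; first by rewrite mulr_ge0.
by rewrite !mulr_ile1 ?mulr_ge0 ?circ'_le1.
Qed.

Lemma circ_lip s : 0 <= s -> `|circ s - circ 0| <= s.
Proof.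
move=> s0.
have [|c _ ->] := @MVT_segment _ circ circ' _ _ s0 (fun x _ => is_derive_circ x).
  by apply: derivable_within_continuous => x _; have [] := is_derive_circ x.
by rewrite subr0 normrM (ger0_norm s0) ler_piMl// circ'_le1.
Qed.

Lemma circ'_lip s : 0 <= s -> `|circ' s - circ' 0| <= s.
Proof.
move=> s0.
have [|c _ ->] := @MVT_segment _ circ' (fun x => - circ x) _ _ s0 (fun x _ => is_derive_circ' x).
  by apply: derivable_within_continuous => x _; have [] := is_derive_circ' x.
by rewrite subr0 normrM (ger0_norm s0) ler_piMl// normrN circ_le1.
Qed.

(** Three variations add up: [|circ| ^ (p - 2)] has Hölder constant [max 1 (p - 2)], [circ' ^ 2] has
    Lipschitz constant 2 and [|circ| ^ p] has [p]. Since [s <= 1], the Lipschitz terms are also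
    bounded through [s <= s ^ g]. *)
Lemma kern2_hoelder s : 0 <= s <= 1 ->
  `|kern2 s - kern2 0| <= hoelder_const p * s `^ Num.min 1 (p - 2).
Proof.
rewrite /hoelder_const => /andP[s0 s1].
set g := Num.min 1 (p - 2); set m := Num.max 1 (p - 2).
have q0 : 0 < p - 2 by have := p2; lra.
have g0 : 0 < g by rewrite lt_min ltr01.
have g1 : g <= 1 by rewrite ge_min lexx.
have m0 : 0 <= m by rewrite le_max ler01.
have s_le : s <= s `^ g.
  have [->|sN0] := eqVneq s 0; first exact: powR_ge0.
  by apply: ger1_powR => //; rewrite lt_def sN0 s0.
have h1 : `| `|circ s| `^ (p - 2) - `|circ 0| `^ (p - 2)| <= m * s `^ g.
  apply: (le_trans (abspow_hoelder q0 (circ_le1 s) (circ_le1 0))).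
  by rewrite ler_wpM2l// ge0_ler_powR ?nnegrE ?(ltW g0)// circ_lip.
have h2 : `| `|circ s| `^ p - `|circ 0| `^ p| <= p * s `^ g.
  have p0 : 0 < p by have := p2; lra.
  apply: (le_trans (abspow_hoelder p0 (circ_le1 s) (circ_le1 0))).
  rewrite max_r ?min_l; [|by have := p2; lra|by have := p2; lra].
  rewrite powRr1// ler_wpM2l ?(ltW p0)//.
  exact: le_trans (circ_lip s0) s_le.
have h3 : `|circ' s ^+ 2 - circ' 0 ^+ 2| <= 2 * s `^ g.
  rewrite subr_sqr normrM mulrC ler_pM//.
    apply: (le_trans (ler_normD _ _)).
    by have := circ'_le1 s; have := circ'_le1 0; lra.
  exact: le_trans (circ'_lip s0) s_le.
have sq1 : `|circ' s ^+ 2| <= 1 by rewrite normrX expr_le1// circ'_le1.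
have /andP[a0 a1] := abspow_le1 (ltW q0) (circ_le1 0).
have h4 : `| `|circ s| `^ (p - 2) * circ' s ^+ 2
     - `|circ 0| `^ (p - 2) * circ' 0 ^+ 2| <= (m + 2) * s `^ g.
  have -> : `|circ s| `^ (p - 2) * circ' s ^+ 2 - `|circ 0| `^ (p - 2) * circ' 0 ^+ 2
    = (`|circ s| `^ (p - 2) - `|circ 0| `^ (p - 2)) * circ' s ^+ 2
      + `|circ 0| `^ (p - 2) * (circ' s ^+ 2 - circ' 0 ^+ 2) by ring.
  apply: (le_trans (ler_normD _ _)); rewrite [leRHS]mulrDl; apply: lerD.
    by rewrite normrM; apply: le_trans h1; rewrite ler_piMr.
  by rewrite normrM; apply: le_trans h3; rewrite (ger0_norm a0) ler_piMl.
rewrite /kern2.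
have -> : forall A B C D : R, p * (p - 1) * A - p * B - (p * (p - 1) * C - p * D) =
   p * (p - 1) * (A - C) - p * (B - D) by move=> *; ring.
apply: (le_trans (ler_normB _ _)); rewrite [leRHS]mulrDl; apply: lerD.
  have pp : 0 <= p * (p - 1) by rewrite mulr_ge0//; have := p2; lra.
  by rewrite normrM (ger0_norm pp) -mulrA ler_wpM2l.
have p0 : 0 <= p by have := p2; lra.
by rewrite normrM (ger0_norm p0) expr2 -mulrA ler_wpM2l.
Qed.

End GreatCircle.

(** * First variation of the energy *)

Section Mixture.
Context {d : measure_display} {T : measurableType d} {R : realType}.
Variables (mu : probability T R) (z : T) (t : R) (t0 : 0 <= t) (t1 : 0 <= 1 - t).

Definition mix : set T -> \bar R :=
  measure_add (mscale (NngNum t1) mu) (mscale (NngNum t0) (dirac z)).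

HB.instance Definition _ := Measure.on mix.

Lemma mix_setT : mix setT = 1%E.
Proof.
rewrite /mix measure_addE -[LHS]/((1 - t)%:E * mu setT + t%:E * \d_z setT)%E.
rewrite probability_setT diracT !mule1.
by rewrite -EFinD subrK.
Qed.

HB.instance Definition _ := Measure_isProbability.Build _ _ _ mix mix_setT.

Definition mixture : probability T R := mix.

Lemma integral_mixture (f : T -> R) : (forall x, 0 <= f x) ->
  measurable_fun setT f ->
  (\int[mixture]_x (f x)%:E =
     (1 - t)%:E * \int[mu]_x (f x)%:E + t%:E * (f z)%:E)%E.
Proof.
move=> f0 mf; rewrite ge0_integral_measure_add//=; last 2 first.
- by move=> x _; rewrite lee_fin.
- exact/measurable_EFinP.
rewrite !ge0_integral_mscale//=; try by move=> x _; rewrite lee_fin.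
all: try exact/measurable_EFinP.
by rewrite integral_dirac ?diracT ?mul1e//; exact/measurable_EFinP.
Qed.

End Mixture.

Section BoundedIntegrable.
Context {d : measure_display} {T : measurableType d} {R : realType}.
Variable mu : probability T R.

Lemma bounded_integrable (f : T -> R) (M : R) :
  measurable_fun setT f -> (forall x, `|f x| <= M) ->
  mu.-integrable setT (EFin \o f).
Proof.
move=> mf fM; apply: measurable_bounded_integrable => //.
  by rewrite -ge0_fin_numE// fin_num_measure.
exists M; split; first exact: num_real.
by move=> K MK x _; exact: le_trans (fM x) (ltW MK).
Qed.

Lemma bounded_integralE (f : T -> R) (M : R) :
  measurable_fun setT f -> (forall x, `|f x| <= M) ->
  (\int[mu]_x (f x)%:E = (\int[mu]_x f x)%R%:E)%E.
Proof.
by move=> mf fM; rewrite fineK//; apply/integrable_fin_num/(bounded_integrable mf fM).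
Qed.

Lemma Rintegral_cst1 (c : R) : \int[mu]_x c = c.
Proof.
by rewrite Rintegral_cst// -[X in fine X]/(mu setT) probability_setT mulr1.
Qed.

Lemma integrable_cst1 (c : R) : mu.-integrable setT (EFin \o (fun _ : T => c)).
Proof. exact: finite_measure_integrable_cst. Qed.

Lemma Rintegral_le_cst (f : T -> R) (c : R) :
  mu.-integrable setT (EFin \o f) -> (forall x, f x <= c) -> \int[mu]_x f x <= c.
Proof.
move=> intf fc; rewrite -[leRHS]Rintegral_cst1.
by apply: (le_Rintegral measurableT intf (integrable_cst1 c)) => x _.
Qed.

End BoundedIntegrable.

(** * Continuity and measurability on the sphere *)

Section Sphere.
Context {R : realType} {n : nat}.
Implicit Types x y z : sphere R n.

Lemma sphere_unit x : dot (sphere_vec x) (sphere_vec x) = 1.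
Proof. exact: (set_mem (proj2_sig x)). Qed.

Lemma sphere_vec_inj : injective (@sphere_vec R n).
Proof. exact: (@val_inj _ _ (set_type [set x : 'rV[R]_n.+1 | dot x x = 1])). Qed.

Lemma continuous_sphere_vec : continuous (@sphere_vec R n).
Proof. exact: initial_continuous. Qed.

Lemma continuous_dot (w : 'rV[R]_n.+1) :
  continuous (fun y : sphere R n => dot w (sphere_vec y)).
Proof.
apply: (@continuous_big R _ +%R 0 _ (@add_continuous R)) => i _ y.
apply: (@continuousM R (sphere R n) (fun=> w 0 i)); first exact: cst_continuous.
apply: (@continuous_comp _ _ _ (@sphere_vec R n) (fun v : 'rV[R]_n.+1 => v 0 i)).
  exact: continuous_sphere_vec.
exact: coord_continuous.
Qed.

Lemma continuous_sphere_measurable (f : sphere R n -> R) :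
  continuous f -> measurable_fun setT f.
Proof.
move=> /continuousP cf; apply: (measurability _ (RGenOpens.measurableE R)).
move=> _ [_ [a [b ->] <-]]; rewrite setTI; apply: sub_sigma_algebra.
exact/cf/interval_open.
Qed.

Lemma measurable_dot (w : 'rV[R]_n.+1) :
  measurable_fun setT (fun y : sphere R n => dot w (sphere_vec y)).
Proof. exact: continuous_sphere_measurable (@continuous_dot w). Qed.

Lemma measurable_abspow (p : R) (f : sphere R n -> R) :
  measurable_fun setT f -> measurable_fun setT (fun y => `|f y| `^ p).
Proof.
move=> mf; have mn : measurable_fun setT (fun y => `|f y|).
  exact: measurableT_comp.
exact: (measurableT_comp (@measurable_powR R p) mn).
Qed.

Lemma dot_sphere_le1 (w : 'rV[R]_n.+1) y : dot w w <= 1 -> `|dot w (sphere_vec y)| <= 1.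
Proof.
move=> w1; rewrite -(@expr_le1 _ 2)// real_normK ?num_real//.
by apply: (le_trans (cauchy_schwarz _ _)); rewrite sphere_unit mulr1.
Qed.

End Sphere.

(** * The potential of a minimizer *)

Section FirstVariation.
Context {R : realType} {n : nat}.
Variables (p : R) (mu : probability (sphere R n) R).
Hypothesis p2 : 2 < p.
Implicit Types x y z : sphere R n.

Let K x y := `|dot (sphere_vec x) (sphere_vec y)| `^ p.
Let F x := potential p mu (sphere_vec x).

Let K01 x y : 0 <= K x y <= 1.
Proof.
have p0 : 0 <= p by have := p2; lra.
by apply: abspow_le1 => //; rewrite dot_sphere_le1// sphere_unit.
Qed.

Let normK_le1 x y : `|K x y| <= 1.
Proof. by rewrite ger0_norm; case/andP: (K01 x y). Qed.

Let KC x y : K x y = K y x.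
Proof. by rewrite /K dotC. Qed.

Let mK x : measurable_fun setT (K x).
Proof. exact: measurable_abspow (measurable_dot _). Qed.

Let mKr z : measurable_fun setT (K ^~ z).
Proof. by apply: eq_measurable_fun (mK z) => x _; exact: KC. Qed.

Let FE x : (\int[mu]_y (K x y)%:E = (F x)%:E)%E.
Proof. exact: bounded_integralE (mK x) (normK_le1 x). Qed.

Let F01 x : 0 <= F x <= 1.
Proof.
apply/andP; split; first by apply: Rintegral_ge0 => y _; case/andP: (K01 x y).
apply: Rintegral_le_cst; first exact: bounded_integrable (mK x) (normK_le1 x).
by move=> y; case/andP: (K01 x y).
Qed.

(** For [p > 2] the Hölder exponent is 1, and Cauchy-Schwarz against a unit [y] bounds the
    difference of inner products. Continuity of the potential follows. *)
Lemma potential_lip x x' :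
  `|F x - F x'| <= p * enorm (sphere_vec x - sphere_vec x').
Proof.
rewrite /F /potential -RintegralB//; last 2 first.
- exact: bounded_integrable (mK x) (normK_le1 x).
- exact: bounded_integrable (mK x') (normK_le1 x').
have mB : measurable_fun setT (fun y => K x y - K x' y) by exact: measurable_funB.
have intB : mu.-integrable setT (EFin \o (fun y => K x y - K x' y)).
  apply: (@bounded_integrable _ _ _ _ _ 2) => // y.
  by apply: (le_trans (ler_normB _ _)); have := normK_le1 x y; have := normK_le1 x' y; lra.
apply: (le_trans (le_normr_Rintegral measurableT intB)).
apply: Rintegral_le_cst; first exact: integrable_norm.
move=> y; have p0 : 0 < p by have := p2; lra.
have h := abspow_hoelder p0 (dot_sphere_le1 y (_ : dot (sphere_vec x) _ <= 1))
  (dot_sphere_le1 y (_ : dot (sphere_vec x') _ <= 1)).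
apply: (le_trans (h _ _)); rewrite ?sphere_unit//.
rewrite max_r ?min_l; [|by have := p2; lra|by have := p2; lra].
rewrite powRr1// ler_wpM2l ?(ltW p0)// -dotBl.
rewrite -sqrtr_sqr ler_sqrt ?dot_ge0//.
by apply: (le_trans (cauchy_schwarz _ _)); rewrite sphere_unit mulr1.
Qed.

Lemma continuous_potential : continuous F.
Proof.
move=> x; apply: (@cvgrPdist_lt _ _ _ (nbhs x) (nbhs_filter x) F (F x)).2 => e e0.
have p0 : 0 < p by have := p2; lra.
(* On the sphere [|x - y| ^ 2 = 2 - 2 x . y], so this threshold on [x . y] says exactly that
   [|x - y| < e / p]. *)
have de : 1 - (e / p) ^+ 2 / 2 < dot (sphere_vec x) (sphere_vec x).
  by rewrite sphere_unit gtrBl divr_gt0// exprn_gt0// divr_gt0.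
have ev : \forall y \near x, 1 - (e / p) ^+ 2 / 2 < dot (sphere_vec x) (sphere_vec y).
  exact: (@cvgr_gt _ _ (nbhs x) (nbhs_filter x) _ _ (@continuous_dot _ _ (sphere_vec x) x) _ de).
near=> y; have hy : 1 - (e / p) ^+ 2 / 2 < dot (sphere_vec x) (sphere_vec y).
  by near: y.
apply: le_lt_trans (potential_lip x y) _.
rewrite mulrC -ltr_pdivlMr// -(ger0_norm (ltW (divr_gt0 e0 p0))).
rewrite -sqrtr_sqr ltr_sqrt ?exprn_gt0 ?divr_gt0//.
rewrite dotBl !dotBr !sphere_unit (dotC (sphere_vec y)); lra.
Unshelve. all: by end_near. Qed.

Let mF : measurable_fun setT F.
Proof. exact: continuous_sphere_measurable continuous_potential. Qed.

Let I := \int[mu]_x F x.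

Let normF_le1 x : `|F x| <= 1.
Proof. by rewrite ger0_norm; case/andP: (F01 x). Qed.

Lemma energyE : energy p mu = I%:E.
Proof.
rewrite /energy; under eq_integral => x _ do rewrite FE.
exact: bounded_integralE mF normF_le1.
Qed.

(** The energy is a symmetric bilinear form evaluated at the mixture; the coefficient of [t ^ 2] is
    [|z . z| ^ p = 1]. *)
Lemma energy_mixture z t (t0 : 0 <= t) (t1 : 0 <= 1 - t) :
  energy p (mixture mu z t0 t1) =
  ((1 - t) ^+ 2 * I + 2 * t * (1 - t) * F z + t ^+ 2)%:E.
Proof.
rewrite /energy.
under eq_integral => x _.
  rewrite integral_mixture; [|by move=> y; exact: powR_ge0|exact: mK].
  rewrite FE -!EFinM -EFinD; over.
rewrite /= integral_mixture; last 2 first.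
- move=> x; have /andP[? _] := F01 x; have /andP[? _] := K01 x z.
  by rewrite addr_ge0// mulr_ge0.
- by apply: measurable_funD; apply: measurable_funM => //; exact: mKr.
have intF := bounded_integrable mu mF normF_le1.
have intK : mu.-integrable setT (EFin \o (K ^~ z)).
  by apply: bounded_integrable (mKr z) _ => x; exact: normK_le1.
have -> : (\int[mu]_x ((1 - t) * F x + t * K x z)%:E =
    ((1 - t) * I + t * F z)%:E)%E.
  transitivity (\int[mu]_x ((1 - t) * F x + t * K x z))%:E.
    apply: (@bounded_integralE _ _ _ _ _ 2).
      by apply: measurable_funD; apply: measurable_funM => //; exact: mKr.
    move=> x; have /andP[? ?] := F01 x; have /andP[? ?] := K01 x z.
    by rewrite ger0_norm ?addr_ge0 ?mulr_ge0//; nra.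
  congr (_%:E); rewrite (RintegralD measurableT
    (integrableZl measurableT (1 - t) intF) (integrableZl measurableT t intK)).
  rewrite (RintegralZl _ measurableT intF) (RintegralZl _ measurableT intK).
  have -> : \int[mu]_x K x z = F z by apply: eq_Rintegral => x _; exact: KC.
  by [].
have -> : `|dot (sphere_vec z) (sphere_vec z)| `^ p = 1.
  by rewrite sphere_unit normr1 powR1.
rewrite -!EFinM -EFinD; congr (_%:E); ring.
Qed.

Hypothesis mu_min : minimizers p mu.

Lemma potential_ge z : I <= F z.
Proof.
rewrite leNgt; apply/negP => FI.
have /andP[F0 F1] := F01 z.
have I1 : I <= 1.
  apply: Rintegral_le_cst; first exact: (bounded_integrable mu mF normF_le1).
  by move=> y; case/andP: (F01 y).
(* The energy changes by [t ^ 2 (1 + I - 2 F z) - 2 t (I - F z)], which for this [t] is at most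
   [2 t ^ 2 - 4 t ^ 2 < 0]. *)
pose t := (I - F z) / 2.
have t0 : 0 <= t by rewrite /t; lra.
have t1 : 0 <= 1 - t by rewrite /t; lra.
have := mu_min (mixture mu z t0 t1); rewrite energyE energy_mixture lee_fin.
have : 0 < t by rewrite /t; lra.
have : I - F z = 2 * t by rewrite /t; field.
nra.
Qed.

(** [F >= I] has mean [I]; if it exceeded [I] at a support point, it would exceed [I + e] on an open
    set of positive measure and raise the mean. *)
Lemma potential_supp x : supp mu x -> F x = I.
Proof.
move=> sx; apply/eqP; rewrite eq_le potential_ge andbT leNgt; apply/negP => IF.
pose e := (F x - I) / 2.
have e0 : 0 < e by rewrite /e; lra.
pose U := F @^-1` `]I + e, +oo[.
have oU : open U.
  by move: continuous_potential => /continuousP; apply; exact: interval_open.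
have Ux : U x by rewrite /U /= in_itv /= andbT /e; lra.
have mU : measurable U by apply: sub_sigma_algebra.
have := sx _ oU Ux.
have muU : mu U \is a fin_num by rewrite fin_num_measure.
rewrite -(fineK muU) lte_fin => muU0.
have intU : mu.-integrable setT (EFin \o (\1_U : sphere R n -> R)).
  apply: (@bounded_integrable _ _ _ _ _ 1) => // y.
  by rewrite indicE; case: (y \in U); rewrite ?normr1 ?normr0.
have intI := integrable_cst1 mu I.
have inteU := integrableZl measurableT e intU.
have : \int[mu]_y (I + e * \1_U y) <= \int[mu]_y F y.
  apply: (le_Rintegral measurableT (integrableD measurableT intI inteU)
    (bounded_integrable mu mF normF_le1)) => y _.
  rewrite indicE; case: (boolP (y \in U)) => [|_].
    by rewrite inE /U /= in_itv /= andbT mulr1 => /ltW.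
  by rewrite mulr0 addr0 potential_ge.
rewrite (RintegralD measurableT intI inteU) Rintegral_cst1.
rewrite (RintegralZl _ measurableT intU).
have -> : \int[mu]_y \1_U y = fine (mu U).
  by rewrite /Rintegral integral_indic// setIT.
rewrite -/I; have := mulr_gt0 e0 muU0; lra.
Qed.

End FirstVariation.

(** * Separation of the support *)

Section DerivativeUnderIntegral.
Context {d : measure_display} {T : measurableType d} {R : realType}.
Variable mu : probability T R.

Lemma is_derive_Rintegral (f f' : R -> T -> R) (M M' s0 : R) :
  (forall s, measurable_fun setT (f s)) -> (forall s y, `|f s y| <= M) ->
  (forall (s : R) y, is_derive s 1 (f ^~ y) (f' s y)) -> (forall s y, `|f' s y| <= M') ->
  is_derive s0 1 (fun s => \int[mu]_y f s y) (\int[mu]_y f' s0 y).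
Proof.
move=> mf fM df f'M.
have sI : `]s0 - 1, s0 + 1[%classic s0 by rewrite /= in_itv /=; apply/andP; lra.
have intf x : `]s0 - 1, s0 + 1[%classic x -> mu.-integrable setT (EFin \o f x).
  by move=> _; exact: bounded_integrable (mf x) (fM x).
have derf x y : `]s0 - 1, s0 + 1[%classic x -> setT y -> derivable (f ^~ y) x 1.
  by move=> _ _; have [] := df x y.
have d1E x y : partial1of2 f x y = f' x y.
  by rewrite partial1of2E; have [] := df x y.
(* The dominating function must be nonnegative, hence [|M'|]; as a constant it is integrable for a
   probability. *)
have M'0 : 0 <= `|M'| by [].
have intM : mu.-integrable setT (EFin \o (fun _ : T => `|M'|)).
  by apply: (@bounded_integrable _ _ _ _ _ `|M'|) => // y; rewrite normr_id.
have bound x y : `]s0 - 1, s0 + 1[%classic x -> setT y -> `|partial1of2 f x y| <= `|M'|.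
  by move=> _ _; rewrite d1E (le_trans (f'M x y))// ler_norm.
split.
  exact: (derivable_under_integral measurableT sI intf derf (fun=> M'0) intM bound).
rewrite -derive1E.
rewrite (differentiation_under_integral measurableT sI intf derf (fun=> M'0) intM bound).
by apply: eq_Rintegral => y _; rewrite d1E.
Qed.

End DerivativeUnderIntegral.

(** * The potential along geodesics from a support point *)

Section Separation.
Context {R : realType} {n : nat}.
Variables (p : R) (mu : probability (sphere R n) R).
Hypothesis p2 : 2 < p.

Section Geodesic.
Variables (x : sphere R n) (v : 'rV[R]_n.+1).
Hypothesis v_unit : dot v v = 1.
Hypothesis xv : dot (sphere_vec x) v = 0.

Let al y := dot (sphere_vec x) (@sphere_vec R n y).
Let be y := dot v (@sphere_vec R n y).
Let geod (s : R) := cos s *: sphere_vec x + sin s *: v.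

Lemma geodesic_unit s : dot (geod s) (geod s) = 1.
Proof.
rewrite dotDl !dotDr !dotZl !dotZr (dotC v) xv v_unit sphere_unit.
by rewrite !(mulr0, mulr1, addr0, add0r) -!expr2 cos2Dsin2.
Qed.

(** Bessel's inequality for the orthonormal pair [x], [v]; it provides [unit_le] for the great
    circle estimates. *)
Lemma bessel y : al y ^+ 2 + be y ^+ 2 <= 1.
Proof.
have := dot_ge0 (sphere_vec y - al y *: sphere_vec x - be y *: v).
rewrite !(dotBl, dotBr, dotZl, dotZr) (dotC v (sphere_vec x)) xv v_unit !sphere_unit.
rewrite !(dotC (sphere_vec y)) -/(al y) -/(be y); nra.
Qed.

Let measurable_circ s : measurable_fun setT (fun y => circ (al y) (be y) s).
Proof.
by apply: measurable_funD; apply: measurable_funM => //; exact: measurable_dot.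
Qed.

Let measurable_circ' s : measurable_fun setT (fun y => circ' (al y) (be y) s).
Proof.
by apply: measurable_funB; apply: measurable_funM => //; exact: measurable_dot.
Qed.

Lemma measurable_kern s : measurable_fun setT (fun y => kern p (al y) (be y) s).
Proof. exact: measurable_abspow (measurable_circ s). Qed.

Lemma measurable_kern1 s : measurable_fun setT (fun y => kern1 p (al y) (be y) s).
Proof.
apply: measurable_funM => //; apply: measurable_funM => //.
by apply: measurable_funM => //; exact: measurable_abspow (measurable_circ s).
Qed.

Lemma measurable_kern2 s : measurable_fun setT (fun y => kern2 p (al y) (be y) s).
Proof.
apply: measurable_funB; apply: measurable_funM => //.
  apply: measurable_funM => //; first exact: measurable_abspow (measurable_circ s).
  exact: measurable_funX.
exact: measurable_abspow (measurable_circ s).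
Qed.

Let g (s : R) := potential p mu (geod s).
Let g1 s := \int[mu]_y kern1 p (al y) (be y) s.
Let g2 s := \int[mu]_y kern2 p (al y) (be y) s.

Let gE : g = fun s => \int[mu]_y kern p (al y) (be y) s.
Proof.
apply/funext => s; apply: eq_Rintegral => y _.
by rewrite /kern /circ dotDl !dotZl.
Qed.

Lemma is_derive_geodesic (s : R) : is_derive s 1 g (g1 s).
Proof.
rewrite gE.
apply: (@is_derive_Rintegral _ _ _ mu (fun s y => kern p (al y) (be y) s)
  (fun s y => kern1 p (al y) (be y) s) 1 p) => [t|t y|t y|t y].
- exact: measurable_kern.
- have /andP[a0 a1] : 0 <= kern p (al y) (be y) t <= 1.
    by apply: abspow_le1; [have := p2; lra|exact: circ_le1 (bessel y) _].
  by rewrite ger0_norm.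
- exact: is_derive_kern.
- exact: kern1_le (bessel y) _.
Qed.

Lemma is_derive_geodesic1 (s : R) : is_derive s 1 g1 (g2 s).
Proof.
apply: (@is_derive_Rintegral _ _ _ mu (fun s y => kern1 p (al y) (be y) s)
  (fun s y => kern2 p (al y) (be y) s) p (p * (p - 1) + p)) => [t|t y|t y|t y].
- exact: measurable_kern1.
- exact: kern1_le (bessel y) _.
- exact: is_derive_kern1.
- exact: kern2_le (bessel y) _.
Qed.

Lemma sphere_hessE : sphere_hess (potential p mu) x v = g2 0.
Proof.
rewrite /sphere_hess derive1nS derive1n1 -/g.
have -> : derive1 g = g1.
  by apply/funext => s; rewrite derive1E; have [] := is_derive_geodesic s.
by rewrite derive1E; have [] := is_derive_geodesic1 0.
Qed.

Lemma second_derivative_lower s : 0 <= s <= 1 ->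
  g2 0 - hoelder_const p * s `^ Num.min 1 (p - 2) <= g2 s.
Proof.
move=> s01; set C := (X in g2 0 - X).
have int0 := bounded_integrable mu (measurable_kern2 0)
  (fun y => kern2_le p2 (bessel y) 0).
have ints := bounded_integrable mu (measurable_kern2 s)
  (fun y => kern2_le p2 (bessel y) s).
have intC := integrable_cst1 mu C.
rewrite lerBlDr addrC -[C in leRHS](Rintegral_cst1 mu).
rewrite -(RintegralD measurableT intC ints).
apply: (le_Rintegral measurableT int0 (integrableD measurableT intC ints)) => y _.
have := kern2_hoelder p2 (bessel y) s01.
by rewrite ler_norml -/C => /andP[]; lra.
Qed.

Hypothesis mu_min : minimizers p mu.
Hypothesis x_supp : supp mu x.

Lemma geodesic_point s : exists y : sphere R n, sphere_vec y = geod s.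
Proof.
have hy : geod s \in [set w : 'rV[R]_n.+1 | dot w w = 1].
  by apply/mem_set; exact: geodesic_unit.
by exists (exist _ (geod s) hy).
Qed.

Lemma geodesic_ge s : g 0 <= g s.
Proof.
have [y ye] := geodesic_point s; rewrite /g -ye.
have -> : geod 0 = sphere_vec x by rewrite /geod cos0 sin0 scale1r scale0r addr0.
by rewrite (potential_supp p2 mu_min x_supp); exact: potential_ge.
Qed.

(** The geodesic extends to both sides of [x], so 0 is an interior minimum of [g]. *)
Lemma geodesic1_0 : g1 0 = 0.
Proof.
have [_ <-] := is_derive_geodesic 0.
have [] := @derive1_at_min _ g (-1) 1 0; rewrite ?in_itv /=; [lra| |lra| |].
- by move=> t _; have [] := is_derive_geodesic t.
- by move=> t _; exact: geodesic_ge.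
- by [].
Qed.

(** The mean value theorem is used twice: [g2 > 0] and [g1 0 = 0] give [g1 > 0], which makes [g]
    increase. *)
Lemma geodesic_gt r s : 0 < s <= r -> (forall t, 0 <= t <= r -> 0 < g2 t) ->
  g 0 < g s.
Proof.
move=> /andP[s0 sr] g2_gt.
have pos t : 0 < t <= r -> 0 < g1 t.
  move=> /andP[t0 tr].
  have <- : g1 t - g1 0 = g1 t by rewrite geodesic1_0 subr0.
  have [|c /itvP c_in ->] := @MVT _ g1 g2 0 t t0 (fun u _ => is_derive_geodesic1 u).
    by apply: derivable_within_continuous => u _; have [] := is_derive_geodesic1 u.
  rewrite subr0; apply: (mulr_gt0 _ t0); apply: g2_gt.
  have c0 : 0 <= c by rewrite c_in.
  by apply/andP; split; [exact: c0|apply: (le_trans _ tr); rewrite c_in].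
rewrite -subr_gt0.
have [|c /itvP c_in ->] := @MVT _ g g1 0 s s0 (fun u _ => is_derive_geodesic u).
  by apply: derivable_within_continuous => u _; have [] := is_derive_geodesic u.
rewrite subr0; apply: (mulr_gt0 _ s0); apply: pos.
have c0 : 0 < c by rewrite c_in.
by apply/andP; split; [exact: c0|apply: (le_trans _ sr); rewrite c_in].
Qed.

End Geodesic.

Lemma geodesic_to (x y : sphere R n) : x <> y -> sphere_dist x y < pi ->
  exists v : 'rV[R]_n.+1, [/\ dot v v = 1, dot (sphere_vec x) v = 0 &
    sphere_vec y = cos (sphere_dist x y) *: sphere_vec x + sin (sphere_dist x y) *: v].
Proof.
move=> xy; set s := sphere_dist x y => spi.
have := dot_sphere_le1 y (_ : dot (sphere_vec x) (sphere_vec x) <= 1).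
rewrite sphere_unit lexx ler_norml => /(_ isT) c11.
have cs : cos s = dot (sphere_vec x) (sphere_vec y) by rewrite /s /sphere_dist acosK.
have s0 : 0 <= s by exact: acos_ge0.
have s_neq0 : s != 0.
  apply/eqP => s00; apply: xy; apply: sphere_vec_inj.
  rewrite s00 cos0 in cs; apply/eqP; rewrite -subr_eq0; apply/eqP/dot_eq0.
  by rewrite !(dotBl, dotBr) !sphere_unit (dotC (sphere_vec y)) -cs; ring.
have ss : 0 < sin s by rewrite sin_gt0_pi// spi andbT lt_def s_neq0.
have ssN : sin s != 0 by rewrite gt_eqF.
(* The component of [y] orthogonal to [x] has norm [sin s], positive because [0 < s < pi]. *)
exists ((sin s)^-1 *: (sphere_vec y - cos s *: sphere_vec x)); split.
- rewrite !(dotZl, dotZr, dotBl, dotBr) !sphere_unit (dotC (sphere_vec y)) -cs.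
  have := cos2Dsin2 s => e.
  transitivity ((sin s)^-1 ^+ 2 * (1 - cos s ^+ 2)); first by ring.
  by rewrite -sin2cos2 exprVn mulVf// expf_neq0.
- by rewrite !(dotZr, dotBr) !sphere_unit -cs mulr1 subrr mulr0.
- by rewrite scalerA divff// scale1r addrC subrK.
Qed.

End Separation.

Lemma hoelder_const_gt0 {R : realType} (p : R) : 1 < p -> 0 < hoelder_const p.
Proof.
move=> p1; have m0 : 0 < Num.max 1 (p - 2) by rewrite lt_max ltr01.
have p0 : 0 < p by lra.
have pp : 0 < p * (p - 1) by rewrite mulr_gt0// subr_gt0.
by rewrite addr_gt0 ?exprn_gt0// mulr_gt0// addr_gt0.
Qed.

Lemma le_hoelder_const {R : realType} (p q : R) : 1 < p -> p <= q ->
  hoelder_const p <= hoelder_const q.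
Proof.
move=> p1 pq; have m0 : 0 < Num.max 1 (p - 2) by rewrite lt_max ltr01.
have mm : Num.max 1 (p - 2) <= Num.max 1 (q - 2).
  by rewrite ge_max !le_max lexx /=; apply/orP; right; lra.
apply: lerD; last by rewrite lerXn2r ?nnegrE//; lra.
apply: ler_pM; [|lra| |lra]; first by rewrite mulr_ge0//; lra.
by apply: ler_pM; lra.
Qed.

(* The upper bound on [t] makes [C * t ^ beta] at most [h / 2]. *)
Lemma hoelder_error_lt {R : realType} (a b p h t : R) :
  2 < a -> a <= p <= b -> 0 < h -> 0 <= t ->
  t <= Num.min 1 ((h / (2 * hoelder_const b)) `^ (Num.min 1 (a - 2))^-1) ->
  hoelder_const p * t `^ Num.min 1 (p - 2) < h.
Proof.
move=> a2 /andP[ap pb] h0 t0; rewrite le_min => /andP[t1 tr].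
set beta := Num.min 1 (a - 2) in tr.
have beta0 : 0 < beta by rewrite lt_min ltr01 subr_gt0.
have p1 : 1 < p by lra.
have C0 : 0 < hoelder_const b by rewrite hoelder_const_gt0//; lra.
have tpow : t `^ Num.min 1 (p - 2) <= t `^ beta.
  have [->|tN0] := eqVneq t 0.
    by rewrite !powR0 ?gt_eqF// lt_min ltr01; lra.
  apply: ger_powR; first by rewrite lt_def tN0 t0.
  by rewrite /beta le_min !ge_min lexx /=; apply/orP; right; lra.
have tbeta : t `^ beta <= h / (2 * hoelder_const b).
  have hC0 : 0 <= h / (2 * hoelder_const b).
    by rewrite divr_ge0 ?mulr_ge0// ltW.
  apply: (@le_trans _ _ (((h / (2 * hoelder_const b)) `^ beta^-1) `^ beta)).
    by apply: ge0_ler_powR; rewrite ?nnegrE ?powR_ge0 ?(ltW beta0).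
  by rewrite -powRrM mulVf ?gt_eqF// powRr1.
apply: (@le_lt_trans _ _ (hoelder_const b * (h / (2 * hoelder_const b)))).
  apply: ler_pM; rewrite ?powR_ge0 ?(ltW (hoelder_const_gt0 p1)) ?le_hoelder_const//.
  exact: le_trans tpow tbeta.
have -> : hoelder_const b * (h / (2 * hoelder_const b)) = h / 2.
  by field; rewrite gt_eqF.
lra.
Qed.

Lemma supp_separated (R : realType) (n : nat) (a b p h r : R)
    (mu : probability (sphere R n) R) :
  2 < a -> a <= p <= b -> minimizers p mu -> 0 < h ->
  (forall x : sphere R n, supp mu x -> sphere_hess_ge (potential p mu) x h) ->
  r = Num.min 1 ((h / (2 * hoelder_const b)) `^ (Num.min 1 (a - 2))^-1) ->
  forall x y : sphere R n, supp mu x -> supp mu y -> x <> y -> r < sphere_dist x y.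
Proof.
move=> a2 apb mu_min h0 hess rE x y sx sy xy.
have p2 : 2 < p by case/andP: apb => ap _; lra.
rewrite ltNge; apply/negP => dist_le.
have r1 : r <= 1 by rewrite rE ge_min lexx.
(* The bound [r <= 1] excludes antipodal pairs, for which the direction of the geodesic is not
   determined. *)
have dist_pi : sphere_dist x y < pi.
  by apply: (le_lt_trans dist_le); have := @pi_ge2 R; lra.
have [v [v1 xv ye]] := geodesic_to xy dist_pi.
set s := sphere_dist x y in dist_le ye.
have c11 : -1 <= dot (sphere_vec x) (sphere_vec y) <= 1.
  by rewrite -ler_norml dot_sphere_le1// sphere_unit.
have s0 : 0 < s.
  apply: acos_gt0; case/andP: c11 => -> le1 /=; rewrite lt_neqAle le1 andbT.
  apply/eqP => e; apply: xy; apply: sphere_vec_inj.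
  apply/eqP; rewrite -subr_eq0; apply/eqP/dot_eq0.
  by rewrite !(dotBl, dotBr) !sphere_unit (dotC (sphere_vec y)) e; ring.
have := hess x sx v v1 xv; rewrite (sphere_hessE mu p2 v1 xv) => hess0.
have := @geodesic_gt R n p mu p2 x v v1 xv mu_min sx r s.
rewrite s0 dist_le => /(_ isT) gt.
(* Both ends lie in the support, so the potential agrees there, against its strict growth along the
   geodesic. *)
have := potential_supp p2 mu_min sy; rewrite -(potential_supp p2 mu_min sx) ye => e.
suff : potential p mu (cos 0 *: sphere_vec x + sin 0 *: v)
    < potential p mu (cos s *: sphere_vec x + sin s *: v).
  by rewrite e cos0 sin0 scale1r scale0r addr0 ltxx.
apply: gt => t /andP[t0 tr].
have t01 : 0 <= t <= 1 by rewrite t0 (le_trans tr).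
apply: lt_le_trans (second_derivative_lower mu p2 v1 xv t01).
rewrite subr_gt0; apply: lt_le_trans hess0.
by apply: hoelder_error_lt a2 apb h0 t0 _; rewrite -rE.
Qed.

(** * Caps on the two-sphere *)

Section PolyIntegral.
Context {R : rcfType}.
Implicit Types p q : {poly R}.

(** The integral of [p] over [[0, 1]], read off the coefficients. *)
Definition pint p : R := \sum_(k < size p) p`_k / k.+1%:R.

Lemma pint_widen n p : (size p <= n)%N -> pint p = \sum_(k < n) p`_k / k.+1%:R.
Proof.
move=> le_n; rewrite /pint (big_ord_widen n (fun k => p`_k / k.+1%:R))//.
rewrite [RHS](bigID (fun k : 'I_n => (k < size p)%N))/= [X in _ + X]big1 ?addr0//.
by move=> k; rewrite -leqNgt => ?; rewrite nth_default// mul0r.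
Qed.

Lemma pintD p q : pint (p + q) = pint p + pint q.
Proof.
pose n := maxn (size p) (size q).
rewrite !(@pint_widen n) ?leq_maxl ?leq_maxr ?size_polyD// -big_split.
by apply: eq_bigr => k _; rewrite coefD mulrDl.
Qed.

Lemma pintZ a p : pint (a *: p) = a * pint p.
Proof.
rewrite (@pint_widen (size p)) ?size_scale_leq// mulr_sumr.
by apply: eq_bigr => k _; rewrite coefZ mulrA.
Qed.

Lemma pint0 : pint 0 = 0.
Proof. by rewrite /pint size_poly0 big_ord0. Qed.

Lemma pint_sum (I : Type) (r : seq I) (P : pred I) (F : I -> {poly R}) :
  pint (\sum_(i <- r | P i) F i) = \sum_(i <- r | P i) pint (F i).
Proof. exact: (big_morph pint pintD pint0). Qed.

Lemma pintXn k : pint ('X^k : {poly R}) = k.+1%:R^-1.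
Proof.
rewrite /pint size_polyXn big_ord_recr big1 /= ?add0r.
  by rewrite coefXn eqxx mul1r.
by move=> i _; rewrite coefXn ltn_eqF ?mul0r.
Qed.

Lemma pint_deriv p : pint p^`() = p.[1] - p.[0].
Proof.
rewrite (@pint_widen (size p)); last first.
  by rewrite (leq_trans (size_poly _ _)) ?leq_pred.
rewrite (@horner_coef_wide _ (size p).+1 p 1)// big_ord_recl expr0 mulr1.
rewrite horner_coef0 [X in X - _]addrC addrK; apply: eq_bigr => k _.
by rewrite coef_deriv expr1n mulr1 -[p`_k.+1 *+ _]mulr_natr mulfK ?pnatr_eq0.
Qed.

Lemma antideriv_exists p : exists2 P : {poly R}, P^`() = p & pint p = P.[1] - P.[0].
Proof.
(* At [i = 0] the division by zero yields 0, a harmless constant term. *)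
pose P := \poly_(i < (size p).+1) (p`_i.-1 / i%:R).
suff dP : P^`() = p by exists P; rewrite // -dP pint_deriv.
apply/polyP => i; rewrite coef_deriv coef_poly ltnS /=.
case: ltnP => [_|le_p]; last by rewrite mul0rn nth_default.
by rewrite -[LHS]mulr_natr divfK ?pnatr_eq0.
Qed.

(** The mean value theorem is applied to an antiderivative on [[0, a]] and on [[a, 1]]. *)
Lemma pint_ge p (a c : R) : 0 < a < 1 ->
  (forall u, 0 <= u <= a -> c <= p.[u]) -> (forall u, a <= u <= 1 -> 0 <= p.[u]) ->
  c * a <= pint p.
Proof.
move=> /andP[a0 a1] ple pge; have [P dP ->] := antideriv_exists p.
have [z1 /itvP z1_in e1] := polyrcf.poly_mvt P a0.
have [z2 /itvP z2_in e2] := polyrcf.poly_mvt P a1.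
rewrite dP subr0 in e1; rewrite dP in e2.
have h1 : c <= p.[z1] by apply: ple; rewrite !z1_in.
have h2 : 0 <= p.[z2] by apply: pge; rewrite !z2_in.
nra.
Qed.

Lemma pint_le p (c : R) : (forall u, 0 <= u <= 1 -> p.[u] <= c) -> pint p <= c.
Proof.
move=> ple; have [P dP ->] := antideriv_exists p.
have [z /itvP z_in ->] := polyrcf.poly_mvt P (@ltr01 R).
by rewrite dP subr0 mulr1 ple// !z_in.
Qed.

(** Euler's beta integral, by integration by parts: [X ^ (i + 1) (1 - X) ^ (j + 1)] vanishes at both
    ends, which trades a power of [1 - X] for one of [X]. *)
Lemma pint_beta i j :
  pint ('X^i * (1 - 'X) ^+ j : {poly R}) * ((i + j).+1`!)%:R = (i`!)%:R * (j`!)%:R.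
Proof.
elim: j i => [|j IH] i.
  by rewrite expr0 mulr1 addn0 fact0 mulr1 pintXn factS natrM mulKf ?pnatr_eq0.
have := pint_deriv ('X^(i.+1) * (1 - 'X) ^+ j.+1).
have -> : ('X^(i.+1) * (1 - 'X) ^+ j.+1)^`() =
    (i.+1%:R : R) *: ('X^i * (1 - 'X) ^+ j.+1)
      + (- j.+1%:R : R) *: ('X^(i.+1) * (1 - 'X) ^+ j).
  rewrite derivM derivXn deriv_exp derivB derivC derivX sub0r /=.
  by rewrite scaleNr !scaler_nat mulrnAl mulN1r mulNrn mulrN mulrnAr.
rewrite !hornerE /= subrr !expr0n /= mulr0 mul0r subrr.
rewrite pintD !pintZ mulNr => /subr0_eq e.
apply: (@mulfI _ i.+1%:R); first by rewrite pnatr_eq0.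
rewrite mulrA e -mulrA -addSnnS IH !factS !natrM; ring.
Qed.

End PolyIntegral.

(** * Averages over roots of unity *)

Section Laplace.
Context {F : fieldType} (M : nat) (w : F) (w_prim : M.-primitive_root w).

Lemma prim_root_neq0 : w != 0.
Proof.
apply/eqP => w0; have := prim_expr_order w_prim; rewrite w0 expr0n.
by rewrite gtn_eqF ?(prim_order_gt0 w_prim)// => /eqP; rewrite eq_sym oner_eq0.
Qed.

(** Orthogonality of characters: for [i != j] this is a geometric sum whose ratio differs from 1 but
    has [M]-th power 1. *)
Lemma sum_prim_root_ratio i j : (i < M)%N -> (j < M)%N ->
  \sum_(l < M) (w ^+ i / w ^+ j) ^+ l = (i == j)%:R * M%:R.
Proof.
move=> iM jM; have w0 := prim_root_neq0.
have [->|ij] := eqVneq i j.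
  rewrite divff ?expf_neq0// mul1r.
  by under eq_bigr do rewrite expr1n; rewrite sumr_const card_ord.
have ne1 : w ^+ i / w ^+ j - 1 != 0.
  rewrite subr_eq0; apply: contra_neq ij => e.
  have /eqP : w ^+ i = w ^+ j by rewrite -[RHS]mul1r -e divfK ?expf_neq0.
  by rewrite (eq_prim_root_expr w_prim) !modn_small// => /eqP.
apply: (mulfI ne1); rewrite mul0r mulr0 -subrX1 expr_div_n -!exprM.
by rewrite !(mulnC _ M) !exprM (prim_expr_order w_prim) !expr1n divr1 subrr.
Qed.

(** Both [k]-th powers expand by the binomial theorem into powers of [z] and [1 / z] with exponents
    at most [k < M]; the sum over roots of unity keeps only equal exponents. *)
Lemma laplace_average k (P Q e : F) : (k < M)%N -> e != 0 ->
  \sum_(l < M) ((P + Q * (w ^+ l * e)) * (P + Q / (w ^+ l * e))) ^+ k =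
  M%:R * \sum_(i < k.+1) (P ^+ (k - i) * Q ^+ i *+ 'C(k, i)) ^+ 2.
Proof.
move=> kM e0.
have w0 := prim_root_neq0.
pose G i : F := P ^+ (k - i) * Q ^+ i *+ 'C(k, i).
have expand z : (P + Q * z) ^+ k = \sum_(i < k.+1) G i * z ^+ i.
  rewrite exprDn; apply: eq_bigr => i _.
  by rewrite exprMn mulrA -mulrnAl.
have orth (i j : 'I_k.+1) :
    \sum_(l < M) (G i * (w ^+ l * e) ^+ i) * (G j * (w ^+ l * e)^-1 ^+ j) =
    (i == j)%:R * (M%:R * G i ^+ 2).
  transitivity (G i * G j * (e ^+ i / e ^+ j) *
      \sum_(l < M) (w ^+ i / w ^+ j) ^+ l).
    rewrite mulr_sumr; apply: eq_bigr => l _.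
    rewrite !(exprVn, exprMn) -!exprM !(mulnC l).
    by field; rewrite !expf_neq0.
  rewrite sum_prim_root_ratio ?(leq_trans (ltn_ord _) kM)//.
  have [->|ij] := eqVneq i j; last by rewrite -val_eqE /= in ij; rewrite (negbTE ij) !mul0r mulr0.
  by rewrite eqxx divff ?expf_neq0// !mul1r mulr1 -expr2 mulrC.
under eq_bigr => l _ do rewrite exprMn !expand big_distrlr /=.
rewrite exchange_big mulr_sumr /=; apply: eq_bigr => i _.
rewrite exchange_big /= (bigD1 i)//= [X in _ + X]big1 ?addr0 => [|j ji].
  by rewrite orth eqxx mul1r.
by rewrite orth eq_sym (negbTE ji) mul0r.
Qed.

End Laplace.

(** [X ^ n - 1] is separable in characteristic 0, so it has [n] distinct roots, among which one is
    primitive. *)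
Lemma prim_root_exists (C : numClosedFieldType) n :
  (0 < n)%N -> exists w : C, n.-primitive_root w.
Proof.
move=> n_gt0; have [r Dp] := closed_field_poly_normal ('X^n - 1 : {poly C}).
rewrite (monicP _) ?monicXnsubC// scale1r in Dp.
have rn1 : all n.-unity_root r by apply/allP=> z; rewrite -root_prod_XsubC -Dp.
have sz_r : (n < (size r).+1)%N.
  by rewrite -(size_prod_XsubC r id) -Dp size_XnsubC.
have [|z] := hasP (cyclic.has_prim_root n_gt0 rn1 _ sz_r); last by exists z.
by rewrite -separable.separable_prod_XsubC -Dp cyclotomic.separable_Xn_sub_1 // pnatr_eq0 -lt0n.
Qed.

Section SphericalMean.
Context {R : rcfType}.

(** The mean of [((1 - x . c) / 2) ^ k] over the longitudes of [x], as a polynomial in the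
    normalized height, for [A = (1 - c2) / 2] and [B = (1 + c2) / 2]. *)
Definition laplace_poly (A B : R) k : {poly R} :=
  \sum_(i < k.+1) (('C(k, i))%:R ^+ 2 * A ^+ (k - i) * B ^+ i)
     *: ('X^(k - i) * (1 - 'X) ^+ i).

(** The beta integral turns one of the two binomial coefficients into [1 / (k + 1)]; the binomial
    theorem sums the rest to [(A + B) ^ k]. *)
Lemma pint_laplace A B k : A + B = 1 -> pint (laplace_poly A B k) = k.+1%:R^-1.
Proof.
move=> AB; rewrite pint_sum.
transitivity (k.+1%:R^-1 * (A + B) ^+ k); last by rewrite AB expr1n mulr1.
rewrite exprDn mulr_sumr; apply: eq_bigr => -[i /= ik] _; rewrite pintZ.
have := @pint_beta R (k - i) i; rewrite (subnK (ltnSE ik)) factS natrM.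
have : (('C(k, i))%:R * ((i`!)%:R * ((k - i)`!)%:R) = (k`!)%:R :> R).
  by rewrite -!natrM bin_fact.
move=> e1 e2.
have -> : pint ('X^(k - i) * (1 - 'X) ^+ i : {poly R}) =
    ((k - i)`!)%N%:R * (i`!)%N%:R / (k.+1%:R * (k`!)%N%:R).
  by rewrite -e2 mulfK// mulf_neq0// pnatr_eq0 -?lt0n ?fact_gt0.
rewrite -[_ *+ 'C(k, i)]mulr_natr -e1; field.
by rewrite !pnatr_eq0 -!lt0n !fact_gt0 bin_gt0 -ltnS ik nat1r pnatr_eq0.
Qed.

Lemma horner_laplace A B k u : (laplace_poly A B k).[u] =
  \sum_(i < k.+1) ('C(k, i))%:R ^+ 2 * (u * A) ^+ (k - i) * ((1 - u) * B) ^+ i.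
Proof.
rewrite horner_sum; apply: eq_bigr => i _.
rewrite hornerZ hornerM hornerXn horner_exp hornerD hornerN hornerX hornerC.
by rewrite !exprMn; ring.
Qed.

Import complex.

Lemma unit_complex_addV (a b : R) : a ^+ 2 + b ^+ 2 = 1 ->
  (Complex a b) != 0 /\ Complex a b + (Complex a b)^-1 = (2 * a)%:C%C.
Proof.
move=> e.
have m1 : Complex a b * Complex a (- b) = 1.
  apply/eqP; rewrite eq_complex /=; apply/andP; split; apply/eqP; last by ring.
  by rewrite -e; ring.
have z0 : Complex a b != 0.
  by apply: contra_eq_neq m1 => ->; rewrite mul0r eq_sym oner_eq0.
split=> //; rewrite -[_^-1]mulr1 -m1 mulKf//.
by apply/eqP; rewrite eq_complex /= subrr eqxx andbT; apply/eqP; ring.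
Qed.

(* [(1 - x . c) / 2 = (P + Q z) (P + Q / z)] with [P ^ 2 = u A],
   [Q ^ 2 = (1 - u) B] and [z] of modulus one, where [u] is the normalized
   height and [z] the longitude of [x]; averaging over the longitude leaves
   the diagonal terms of the double binomial expansion. *)
Lemma spherical_mean M : (0 < M)%N -> exists x0 x1 : 'I_M -> R,
  (forall l, x0 l ^+ 2 + x1 l ^+ 2 = 1) /\
  forall c0 c1 c2 : R, c0 ^+ 2 + c1 ^+ 2 + c2 ^+ 2 = 1 ->
  exists A B, A + B = 1 /\
  forall k u, (k < M)%N -> 0 <= u <= 1 ->
  \sum_(l < M) ((1 - (2 * Num.sqrt (u * (1 - u)) * x0 l * c0
                  + 2 * Num.sqrt (u * (1 - u)) * x1 l * c1
                  + (2 * u - 1) * c2)) / 2) ^+ k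
   = M%:R * (laplace_poly A B k).[u].
Proof.
move=> M0; have [w w_prim] := prim_root_exists R[i] M0.
have normw l : `|w ^+ l| = 1.
  have : `|w| ^+ M == 1 by rewrite -normrX (prim_expr_order w_prim) normr1.
  by rewrite pexpr_eq1// normrX => /eqP ->; rewrite expr1n.
pose x0 (l : 'I_M) := complex.Re (w ^+ l); pose x1 (l : 'I_M) := complex.Im (w ^+ l).
have x_unit l : x0 l ^+ 2 + x1 l ^+ 2 = 1.
  by apply: complexI; rewrite add_Re2_Im2 normw expr1n.
exists x0, x1; split=> //.
move=> c0 c1 c2 c_unit; exists ((1 - c2) / 2), ((1 + c2) / 2).
split; first by field.
move=> k u kM /andP[u0 u1].
set A := (1 - c2) / 2; set B := (1 + c2) / 2.
have A0 : 0 <= A by rewrite /A; nra.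
have B0 : 0 <= B by rewrite /B; nra.
have AB0 : 0 <= A * B by rewrite mulr_ge0.
pose t := 2 * Num.sqrt (A * B).
have t_sq : t ^+ 2 = c0 ^+ 2 + c1 ^+ 2.
  by rewrite /t exprMn sqr_sqrtr// /A /B; nra.
(* The unit number [e] satisfies [t e = - c0 + i c1], so that [t Re (w ^ l e) = - (x0 c0 + x1 c1)].
   At a pole [t = 0] and any unit number serves. *)
have [e0 [e1 [e_unit te0 te1]]] : exists e0 e1 : R,
    [/\ e0 ^+ 2 + e1 ^+ 2 = 1, t * e0 = - c0 & t * e1 = c1].
  have [t0|t0] := eqVneq t 0.
    exists 1, 0; rewrite t0 expr1n expr0n addr0 !mul0r.
    by rewrite t0 expr0n /= in t_sq; split=> //; nra.
  exists (- c0 / t), (c1 / t); split; [|by field|by field].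
  by rewrite !expr_div_n sqrrN -mulrDl -t_sq divff// expf_neq0.
pose P := Num.sqrt (u * A); pose Q := Num.sqrt ((1 - u) * B).
have v0 : 0 <= 1 - u by rewrite subr_ge0.
have uA0 : 0 <= u * A by rewrite mulr_ge0.
have vB0 : 0 <= (1 - u) * B by rewrite mulr_ge0.
have uv0 : 0 <= u * (1 - u) by rewrite mulr_ge0.
have PQ : 2 * P * Q = Num.sqrt (u * (1 - u)) * t.
  rewrite /t mulrCA -sqrtrM// /P /Q -mulrA -sqrtrM//.
  by congr (_ * Num.sqrt _); ring.
pose e := Complex e0 e1.
have e_neq0 : e != 0 by have [] := unit_complex_addV e_unit.
have point l : (((1 - (2 * Num.sqrt (u * (1 - u)) * x0 l * c0
      + 2 * Num.sqrt (u * (1 - u)) * x1 l * c1 + (2 * u - 1) * c2)) / 2)%:C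
    = (P%:C + Q%:C * (w ^+ l * e)) * (P%:C + Q%:C / (w ^+ l * e)))%C.
  have -> : w ^+ l * e = Complex (x0 l * e0 - x1 l * e1) (x0 l * e1 + x1 l * e0).
    by rewrite /x0 /x1; case: (w ^+ l).
  set a := x0 l * e0 - x1 l * e1; set b := x0 l * e1 + x1 l * e0.
  have ab : a ^+ 2 + b ^+ 2 = 1.
    transitivity ((x0 l ^+ 2 + x1 l ^+ 2) * (e0 ^+ 2 + e1 ^+ 2)).
      by rewrite /a /b; ring.
    by rewrite x_unit e_unit mulr1.
  have [] := unit_complex_addV ab; set z := Complex a b => z0 zV.
  transitivity (P%:C ^+ 2 + Q%:C ^+ 2 + P%:C * Q%:C * (z + z^-1))%C; last first.
    by field.
  rewrite zV -!rmorphXn -!rmorphM -!rmorphD; congr (_%:C)%C.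
  rewrite /= !sqr_sqrtr//.
  transitivity (u * A + (1 - u) * B + (2 * P * Q) * a); last by ring.
  rewrite PQ /a.
  transitivity (u * A + (1 - u) * B + Num.sqrt (u * (1 - u)) *
     (x0 l * (t * e0) - x1 l * (t * e1))); last by ring.
  by rewrite te0 te1 /A /B; field.
apply: complexI; rewrite rmorph_sum.
under eq_bigr => l _ do rewrite rmorphXn /= point.
rewrite (laplace_average w_prim)// rmorphM rmorph_nat; congr (_ * _).
rewrite horner_laplace rmorph_sum; apply: eq_bigr => i _.
rewrite -[_ *+ 'C(k, i)]mulr_natr -(rmorph_nat (real_complex R)).
rewrite -!(rmorphXn (real_complex R)) -!(rmorphM (real_complex R)).
rewrite -(rmorphXn (real_complex R)); congr (_%:C)%C.
have P2 : P ^+ 2 = u * A by rewrite sqr_sqrtr.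
have Q2 : Q ^+ 2 = (1 - u) * B by rewrite sqr_sqrtr.
rewrite /= -P2 -Q2 !exprMn -(exprM P (k - i)) -(exprM Q i) !(mulnC _ 2).
by rewrite !(exprM _ 2) !(exprAC _ 2); ring.
Qed.

End SphericalMean.

(** * Polynomial approximation of a step *)

Section StepApproximation.
Context {R : realType}.

Lemma expr_lt_eps (x e : R) : 0 <= x < 1 -> 0 < e -> exists n, x ^+ n < e.
Proof.
move=> /andP[x0 x1] e0; apply/not_existsP => h.
suff : 1 <= x by rewrite leNgt x1.
apply: (@pow_le_const_mul_pow _ _ _ (e^-1)) => //.
  rewrite lt_def x0 andbT; apply/eqP => x00.
  by apply: (h 1%N); rewrite x00 expr1.
move=> k; rewrite expr1n ler_pdivlMl// mulr1 leNgt; apply/negP; exact: h.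
Qed.

Lemma bernoulli (y : R) m : 0 <= y -> 1 + m%:R * y <= (1 + y) ^+ m.
Proof.
move=> y0; elim: m => [|m IH]; first by rewrite mul0r addr0 expr0.
have my : 0 <= m%:R * y by rewrite mulr_ge0.
rewrite exprS -natr1; nra.
Qed.

Lemma bernoulli_opp (y : R) m : 0 <= y <= 1 -> 1 - m%:R * y <= (1 - y) ^+ m.
Proof.
move=> /andP[y0 y1]; elim: m => [|m IH]; first by rewrite mul0r subr0 expr0.
have my : 0 <= m%:R * y by rewrite mulr_ge0.
have := exprn_ge0 m (_ : 0 <= 1 - y); rewrite subr_ge0 => /(_ y1) ?.
rewrite exprS -natr1; nra.
Qed.

(* [(1 - u ^ n) ^ m] with [m] about [d ^ -n] drops from 1 to 0 around [u = d];
   any [d] between [a] and [s] will do. *)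
Lemma step_approx (a s e : R) : 0 < a -> a < s -> s < 1 -> 0 < e ->
  exists q : {poly R}, [/\ forall u, 0 <= u <= 1 -> 0 <= q.[u] <= 1,
    forall u, s <= u <= 1 -> q.[u] <= e & (1 - 2 * e) * a <= pint q].
Proof.
move=> a0 as_ s1 e0; have [d [ad ds]] : exists d, a < d /\ d < s by exists ((a + s) / 2); lra.
have d0 : 0 < d by lra.
(* These are the three ratios whose [n]-th powers have to fall below [e]. *)
pose x := Num.max (Num.max (a / d) (d / s)) a.
have x_lt : 0 <= x < 1.
  apply/andP; split; first by rewrite /x le_max (ltW a0) orbT.
  rewrite /x !gt_max !ltr_pdivrMr ?mul1r; lra.
have [n xn] := expr_lt_eps x_lt e0.
pose m := (Num.truncn (d ^- n)).+1.
have dn0 : 0 < d ^- n by rewrite invr_gt0 exprn_gt0.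
have m_ge : d ^- n <= m%:R by rewrite ltW// truncnS_gt.
have m_le : m%:R <= d ^- n + 1.
  by rewrite /m -natr1 lerD2r truncn_le// ltW.
have small y : 0 <= y <= x -> y ^+ n < e.
  move=> /andP[y0 yx]; apply: le_lt_trans xn; apply: lerXn2r; rewrite ?nnegrE//.
  exact: le_trans y0 yx.
have [x1 x2 x3] : [/\ a / d <= x, d / s <= x & a <= x].
  by rewrite /x !le_max !lexx !orbT.
have qE u : ((1 - 'X^n) ^+ m).[u] = (1 - u ^+ n) ^+ m :> R.
  by rewrite horner_exp hornerD hornerN hornerXn hornerC.
exists ((1 - 'X^n) ^+ m); split.
- move=> u /andP[u0 u1]; rewrite qE.
  have un : 0 <= 1 - u ^+ n by rewrite subr_ge0 exprn_ile1.
  by rewrite exprn_ge0//= exprn_ile1// gerBl exprn_ge0.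
- move=> u /andP[us u1]; rewrite qE.
  have u0 : 0 < u by lra.
  have un0 : 0 < u ^+ n by rewrite exprn_gt0.
  have un1 : u ^+ n <= 1 by rewrite exprn_ile1// ltW.
  (* By Bernoulli the second factor is at least [m u ^ n >= 1 / e], which forces the first below
     [e]. *)
  have h1 : (1 - u ^+ n) ^+ m * (1 + u ^+ n) ^+ m <= 1.
    by rewrite -exprMn exprn_ile1//; nra.
  have h2 := bernoulli m (ltW un0).
  have h3 : e^-1 <= m%:R * u ^+ n.
    apply: (@le_trans _ _ (d ^- n * u ^+ n)); last by rewrite ler_wpM2r// ltW.
    have -> : d ^- n * u ^+ n = ((d / u) ^+ n)^-1.
      by rewrite expr_div_n invf_div mulrC.
    rewrite lef_pV2 ?posrE ?exprn_gt0 ?divr_gt0//; apply/ltW/small.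
    rewrite divr_ge0 ?(ltW d0) ?(ltW u0)//=; apply: le_trans x2.
    by rewrite ler_pM2l// lef_pV2 ?posrE//; lra.
  have q0 : 0 <= (1 - u ^+ n) ^+ m by rewrite exprn_ge0// subr_ge0.
  have h4 : (1 - u ^+ n) ^+ m * e^-1 <= 1.
    apply: le_trans h1; apply: ler_wpM2l => //.
    by apply: (le_trans h3); apply: le_trans h2; rewrite lerDr.
  by rewrite ler_pdivrMr// mul1r in h4.
- apply: pint_ge; first by rewrite a0; lra.
    move=> u /andP[u0 ua]; rewrite qE.
    have un : 0 <= u ^+ n <= 1 by rewrite exprn_ge0//= exprn_ile1//; lra.
    (* The loss [m u ^ n] is at most [(u / d) ^ n + u ^ n < 2 e]. *)
    apply: le_trans (bernoulli_opp m un); rewrite lerD2l lerN2.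
    apply: (@le_trans _ _ ((d ^- n + 1) * u ^+ n)).
      by rewrite ler_wpM2r//; case/andP: un.
    rewrite mulrDl mul1r mulrC -expr_div_n mulrDl mul1r.
    have e1 : (u / d) ^+ n < e.
      by apply: small; rewrite divr_ge0 ?(ltW d0)//= (le_trans _ x1)// ler_pM2r// invr_gt0.
    have e2 : u ^+ n < e by apply: small; rewrite u0 (le_trans ua).
    by lra.
  move=> u /andP[u0 u1]; rewrite qE exprn_ge0// subr_ge0 exprn_ile1//; lra.
Qed.

End StepApproximation.

(** * Disjoint caps of normalized area [s] *)

Section CapPacking.
Context {R : realType} {N : nat} (c : 'I_N -> 'rV[R]_3) (s : R).
Hypothesis c_unit : forall i, dot (c i) (c i) = 1.
Hypothesis s01 : 0 < s < 1.
Hypothesis caps_disjoint : forall x i j, dot x x = 1 ->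
  (1 - dot x (c i)) / 2 < s -> (1 - dot x (c j)) / 2 < s -> i = j.

(** At most one cap contains [x]; its term is at most 1 and every other term at most [e]. *)
Lemma sum_bump_le (q : {poly R}) (e : R) x : 0 <= e ->
  (forall u, 0 <= u <= 1 -> 0 <= q.[u] <= 1) ->
  (forall u, s <= u <= 1 -> q.[u] <= e) -> dot x x = 1 ->
  \sum_(i < N) q.[(1 - dot x (c i)) / 2] <= 1 + N%:R * e.
Proof.
move=> e0 q01 qe x1.
have in01 i : 0 <= (1 - dot x (c i)) / 2 <= 1.
  by have := cauchy_schwarz x (c i); rewrite x1 c_unit; nra.
have sum_e : \sum_(i < N) e = N%:R * e by rewrite sumr_const card_ord mulr_natl.
rewrite -sum_e.
case: (pickP (fun i => (1 - dot x (c i)) / 2 < s)) => [i0 i0s|far]; last first.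
  apply: (@le_trans _ _ (\sum_(i < N) e)); last by rewrite lerDr.
  by apply: ler_sum => i _; apply: qe; rewrite leNgt far; case/andP: (in01 i).
rewrite (bigD1 i0)//= [X in _ <= _ + X](bigD1 i0)//= addrA lerD//.
  by have := q01 _ (in01 i0); lra.
apply: ler_sum => i ii0; apply: qe; rewrite leNgt.
have -> /= : ~~ ((1 - dot x (c i)) / 2 < s).
  by apply/negP => iis; move: ii0; rewrite (caps_disjoint x1 iis i0s) eqxx.
by case/andP: (in01 i).
Qed.

Lemma row3_dot (a0 a1 a2 : R) (v : 'rV[R]_3) :
  dot (\row_(j < 3) nth 0 [:: a0; a1; a2] j) v
    = a0 * v 0 0 + a1 * v 0 1 + a2 * v 0 (lift ord0 (lift ord0 ord0)).
Proof.
rewrite /dot !big_ord_recl big_ord0 !mxE /= addr0 addrA.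
by congr (_ + _ * v 0 _ + _); apply/val_inj.
Qed.

Lemma row3_unit (x0 x1 u : R) : x0 ^+ 2 + x1 ^+ 2 = 1 -> 0 <= u <= 1 ->
  let x := \row_(j < 3) nth 0 [:: 2 * Num.sqrt (u * (1 - u)) * x0;
                                2 * Num.sqrt (u * (1 - u)) * x1; 2 * u - 1] j in
  dot x x = 1.
Proof.
move=> e /andP[u0 u1] x; rewrite row3_dot !mxE /=.
have := @sqr_sqrtr _ (u * (1 - u)); rewrite mulr_ge0 ?subr_ge0// => /(_ isT).
set r := Num.sqrt _ => r2.
transitivity (4 * r ^+ 2 * (x0 ^+ 2 + x1 ^+ 2) + (2 * u - 1) ^+ 2); first by ring.
by rewrite e r2; ring.
Qed.

(** The pointwise bound is averaged over longitudes and integrated over heights; each centre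
    contributes [pint q], wherever it lies. *)
Lemma pint_bump_le (q : {poly R}) (e : R) : 0 <= e ->
  (forall u, 0 <= u <= 1 -> 0 <= q.[u] <= 1) ->
  (forall u, s <= u <= 1 -> q.[u] <= e) ->
  N%:R * pint q <= 1 + N%:R * e.
Proof.
move=> e0 q01 qe; pose M := (size q).+1.
have [x0 [x1 [x_unit mean]]] := @spherical_mean R M (ltn0Sn _).
have cE i : (c i) 0 0 ^+ 2 + (c i) 0 1 ^+ 2
    + (c i) 0 (lift ord0 (lift ord0 ord0)) ^+ 2 = 1.
  rewrite -(c_unit i) /dot !big_ord_recl big_ord0 addr0 addrA -!expr2.
  by congr (_ + (c i) 0 _ ^+ 2 + _); apply/val_inj.
have ex i : exists AB : R * R, AB.1 + AB.2 = 1 /\ forall k u, (k < M)%N ->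
    0 <= u <= 1 ->
    \sum_(l < M) ((1 - dot (\row_(j < 3)
       nth 0 [:: 2 * Num.sqrt (u * (1 - u)) * x0 l;
                 2 * Num.sqrt (u * (1 - u)) * x1 l; 2 * u - 1] j) (c i)) / 2) ^+ k
      = M%:R * (laplace_poly AB.1 AB.2 k).[u].
  have [A [B [AB1 h]]] := mean _ _ _ (cE i).
  exists (A, B); split=> // k u kM u01; rewrite -h//.
  by apply: eq_bigr => l _; rewrite row3_dot.
have [AB /all_and2 [AB1 h]] := choice ex.
(* At height [u], [H] is the mean over longitudes of the sum of bumps. *)
pose H := \sum_(i < N) \sum_(k < size q) q`_k *: laplace_poly (AB i).1 (AB i).2 k.
have -> : N%:R * pint q = pint H.
  rewrite pint_sum -[N in LHS]card_ord mulr_natl -sumr_const.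
  apply: eq_bigr => i _; rewrite pint_sum; apply: eq_bigr => k _.
  by rewrite pintZ pint_laplace.
apply: pint_le => u u01.
have M0 : 0 < M%:R :> R by rewrite ltr0n.
rewrite -(ler_pM2l M0).
pose x l := \row_(j < 3) nth 0 [:: 2 * Num.sqrt (u * (1 - u)) * x0 l;
                                2 * Num.sqrt (u * (1 - u)) * x1 l; 2 * u - 1] j.
have -> : M%:R * H.[u] = \sum_(l < M) \sum_(i < N) q.[(1 - dot (x l) (c i)) / 2].
  rewrite exchange_big /H horner_sum mulr_sumr; apply: eq_bigr => i _.
  under [RHS]eq_bigr => l _ do rewrite horner_coef.
  rewrite exchange_big horner_sum mulr_sumr; apply: eq_bigr => k _.
  rewrite hornerZ mulrCA -h// ?mulr_sumr//.
  exact: (leq_trans (ltn_ord k) (leqnSn _)).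
have -> : M%:R * (1 + N%:R * e) = \sum_(l < M) (1 + N%:R * e).
  by rewrite sumr_const card_ord mulr_natl.
apply: ler_sum => l _; apply: sum_bump_le => //.
exact: row3_unit.
Qed.

Lemma cap_packing : N%:R * s <= 1.
Proof.
rewrite leNgt; apply/negP => Ns; have /andP[s0 s1] := s01.
have N0 : 0 < N%:R :> R.
  by rewrite lt_def ler0n andbT; apply: contraTneq Ns => ->; rewrite mul0r ltr10.
have [a [a0 as_ Na]] : exists a, [/\ 0 < a, a < s & 1 < N%:R * a].
  exists ((N%:R^-1 + s) / 2).
  have h : N%:R^-1 < s by rewrite -(ltr_pM2l N0) divff ?gt_eqF.
  have i0 : 0 < (N%:R : R)^-1 by rewrite invr_gt0.
  split; [lra|lra|].
  by rewrite mulrA mulrDr divff ?gt_eqF// ltr_pdivlMr//; lra.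
(* The bump bound gives [N a - 1 <= N e + 2 N e a <= 3 N e], while this choice makes
   [N a - 1 = 6 N e]. *)
pose e := (N%:R * a - 1) / (6 * N%:R).
have e0 : 0 < e by rewrite divr_gt0//; lra.
have [q [q01 qe qint]] := step_approx a0 as_ s1 e0.
have := pint_bump_le (ltW e0) q01 qe.
have eN : 6 * (N%:R * e) = N%:R * a - 1 by rewrite /e; field; rewrite gt_eqF.
have Nq : N%:R * ((1 - 2 * e) * a) <= N%:R * pint q by rewrite ler_pM2l.
have : N%:R * e * a <= N%:R * e * 1 by rewrite ler_wpM2l//; [nra|lra].
have Ne : 0 < N%:R * e by rewrite mulr_gt0.
nra.
Qed.

End CapPacking.

(** * Counting *)

Section Trigo.
Context {R : realType}.
Implicit Types t : R.

Lemma sin_le t : 0 <= t -> sin t <= t.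
Proof.
move=> t0.
have [|c _] := @MVT_segment _ (@sin R) (@cos R) 0 t t0 (fun u _ => is_derive_sin u).
  by apply: derivable_within_continuous => u _; have [] := is_derive_sin u.
by rewrite sin0 !subr0 => ->; rewrite ler_piMl// cos_le1.
Qed.

Lemma cos_ge t : 0 <= t -> 1 - t ^+ 2 / 2 <= cos t.
Proof.
move=> t0.
pose f := @cos R + 2^-1 \*: ((id : R -> R) ^+ 2).
have df (u : R) : is_derive u 1 f (u - sin u).
  by apply: is_derive_eq; rewrite -![_ *: _]/(_ * _); field.
have [|c /itvP c_in] := @MVT_segment _ f (fun u => u - sin u) 0 t t0 (fun u _ => df u).
  by apply: derivable_within_continuous => u _; have [] := df u.
have fE u : f u = cos u + 2^-1 * u ^+ 2 by [].
rewrite !fE cos0 expr0n mulr0 addr0 subr0 => e.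
have : 0 <= (c - sin c) * t by rewrite mulr_ge0// subr_ge0 sin_le// c_in.
by rewrite -e; lra.
Qed.

(* [sin t >= (7 / 8) t] on [[0, 1 / 2]] and [2 / pi <= 3 / 4 < 7 / 8]. *)
Lemma sin_ge_pi t : 0 <= t <= 2^-1 -> 2 * t / pi <= sin t.
Proof.
move=> /andP[t0 t1].
(* Since [cos (pi / 2) = 0], the quadratic lower bound for the cosine gives [pi ^ 2 >= 8]. *)
have pi_ge : 8 / 3 <= pi :> R.
  have := @cos_ge (pi / 2); rewrite cos_pihalf => /(_ _).
  have := @pi_gt0 R => pi0 h.
  have {}h : 1 - (pi / 2) ^+ 2 / 2 <= 0 :> R by apply: h; lra.
  rewrite leNgt; apply/negP => lt; nra.
have [|c /itvP c_in] := @MVT_segment _ (@sin R) (@cos R) 0 t t0 (fun u _ => is_derive_sin u).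
  by apply: derivable_within_continuous => u _; have [] := is_derive_sin u.
rewrite sin0 !subr0 => ->.
have c0 : 0 <= c by rewrite c_in.
have ct : c <= t by rewrite c_in.
have := cos_ge c0 => cosc.
have pi0 := @pi_gt0 R.
rewrite ler_pdivrMr//.
have h : 7 / 8 <= cos c by nra.
have : 2 <= cos c * pi by nra.
nra.
Qed.

End Trigo.

(** * Cardinality of separated families *)

Section Counting.
Context {R : realType} {n N : nat} (c : 'I_N -> sphere R n) (r : R).
Hypothesis r01 : 0 < r <= 1.
Hypothesis c_sep : forall i j, i != j -> r < sphere_dist (c i) (c j).

Lemma dot_lt_cos i j : i != j -> dot (sphere_vec (c i)) (sphere_vec (c j)) < cos r.
Proof.
move=> ij; have := c_sep ij; have /andP[r0 r1] := r01.
have c11 : -1 <= dot (sphere_vec (c i)) (sphere_vec (c j)) <= 1.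
  by rewrite -ler_norml dot_sphere_le1// sphere_unit.
have dE : cos (sphere_dist (c i) (c j)) = dot (sphere_vec (c i)) (sphere_vec (c j)).
  by rewrite /sphere_dist acosK.
rewrite -dE ltr_cos// in_itv /= ?acos_ge0 ?acos_lepi//.
by rewrite (ltW r0) (le_trans r1)// (le_trans _ (pi_ge2 R))// ler1n.
Qed.

Lemma cos_half : cos r = 2 * cos (r / 2) ^+ 2 - 1.
Proof. by rewrite {1}[r]splitr -mulr2n cos_mulr2n mulr_natl. Qed.

(** Scaling by [pi / r] gives norm [kappa - 1]; chords are at least [2 sin (r / 2) >= 2 r / pi],
    hence at least 2 after scaling. *)
Lemma volume_count : N%:R <= (1 + pi / r) ^+ n.+1.
Proof.
have /andP[r0 r1] := r01; have pi0 := @pi_gt0 R.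
apply: (@packing_bound _ _ _ _ (fun i => (pi / r) *: sphere_vec (c i))).
- by rewrite ltrDl divr_gt0.
- move=> i; rewrite enormZ ?divr_ge0 ?(ltW pi0) ?(ltW r0)// /enorm sphere_unit sqrtr1.
  by rewrite mulr1 addrAC subrr add0r.
- move=> i j ij; rewrite -scalerBr enormZ ?divr_ge0 ?(ltW pi0) ?(ltW r0)//.
  rewrite mulrAC ler_pdivlMr// [pi * _]mulrC -ler_pdivrMr//.
  have half : 0 <= r / 2 <= 2^-1 by apply/andP; split; lra.
  have := sin_ge_pi half; set sn := sin _ => hs.
  have sn0 : 0 <= sn by apply: le_trans hs; rewrite divr_ge0 ?(ltW pi0)//; lra.
  rewrite /enorm; apply: (@le_trans _ _ (Num.sqrt ((2 * sn) ^+ 2))).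
    rewrite sqrtr_sqr ger0_norm ?mulr_ge0//.
    have -> : 2 * r / pi = 2 * (2 * (r / 2) / pi).
      by rewrite [RHS]mulrA; congr (_ / _); field.
    by rewrite ler_pM2l.
  rewrite ler_sqrt ?dot_ge0// !(dotBl, dotBr) !sphere_unit (dotC (sphere_vec (c j))).
  have := dot_lt_cos ij; rewrite cos_half (cos2sin2 (r / 2)) -/sn; nra.
Qed.

(** Caps of angular radius [r / 2] have normalized area [(1 - cos (r / 2)) / 2] and are disjoint. *)
Lemma cap_count : n = 2%N -> N%:R <= 2 / (1 - cos (r / 2)).
Proof.
have /andP[r0 r1] := r01; have pi2 := @pi_ge2 R; have pi0 := @pi_gt0 R.
have cos_lt1 : cos (r / 2) < 1.
  by rewrite -[ltRHS]cos0 ltr_cos ?in_itv /= ?lexx /=; lra.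
have cos_gt0 : 0 < cos (r / 2) by apply: cos_gt0_pihalf; apply/andP; lra.
move=> n2; rewrite ler_pdivlMr ?subr_gt0//.
suff : N%:R * ((1 - cos (r / 2)) / 2) <= 1 by lra.
move: c c_sep dot_lt_cos; rewrite n2 => c' _ dot_lt.
apply: (@cap_packing R N (fun i => sphere_vec (c' i))).
- by move=> i; rewrite sphere_unit.
- by apply/andP; lra.
- move=> x i j x1 xi xj; apply/eqP/negPn/negP => ij.
  have := dot_lt _ _ ij; rewrite cos_half.
  (* A common [x] would give [4 cos (r / 2) ^ 2 < |c_i + c_j| ^ 2 = 2 + 2 c_i . c_j < 2 + 2 cos r],
     whose ends are equal. *)
  have := cauchy_schwarz (sphere_vec (c' i) + sphere_vec (c' j)) x.
  rewrite !(dotDl, dotDr) !sphere_unit x1 (dotC _ x) (dotC (sphere_vec (c' j)) x).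
  rewrite (dotC (sphere_vec (c' j)) (sphere_vec (c' i))).
  nra.
Qed.

End Counting.

Lemma fset_enum_sep (R : realType) (n : nat) (r : R) (A : set (sphere R n))
    (B : {fset sphere R n}) :
  (forall x y, A x -> A y -> x <> y -> r < sphere_dist x y) -> [set` B] `<=` A ->
  exists c : 'I_#|` B| -> sphere R n,
    forall i j, i != j -> r < sphere_dist (c i) (c j).
Proof.
move=> sep BA; exists (fun i => tnth (in_tuple (enum_fset B)) i) => i j ij.
have inA k : A (tnth (in_tuple (enum_fset B)) k) by apply/BA/mem_tnth.
apply: sep => //; apply/eqP.
by rewrite !(tnth_nth point) nth_uniq ?fset_uniq.
Qed.

(** An infinite set has finite subsets with more than [M] elements. *)
Lemma bounded_finite_set (T : choiceType) (R : realType) (M : R) (A : set T) :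
  (forall B : {fset T}, [set` B] `<=` A -> #|` B|%:R <= M) -> finite_set A.
Proof.
move=> AM; apply: contrapT => /infinite_set_fset.
move=> /(_ (Num.truncn M).+1) [B BA leB].
have := AM B BA; rewrite leNgt => /negP; apply.
by apply: lt_le_trans (truncnS_gt M) _; rewrite ler_nat.
Qed.

Unset Implicit Arguments.

Theorem proposition5p3 (R : realType) (d : nat) (a b p h : R)
    (mu : probability (sphere R d.-1) R) :
  (2 <= d)%N -> 2 < a -> a <= b ->
  p \in `[a, b] ->
  minimizers p mu ->
  0 < h ->
  (forall x : sphere R d.-1, supp mu x ->
     sphere_hess_ge (potential p mu) x h) ->
  let beta : R := Num.min 1 (a - 2) in
  let C_J : R := b * (b - 1) * (Num.max 1 (b - 2) + 2) + b ^+ 2 in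
  let r : R := Num.min 1 ((h / (2 * C_J)) `^ beta^-1) in
  [/\ forall x y : sphere R d.-1, supp mu x -> supp mu y -> x <> y ->
        r < sphere_dist x y,
      finite_set (supp mu),
      #|` fset_set (supp mu)|%:R <= (1 + pi / r) ^+ d &
      d = 3%N -> #|` fset_set (supp mu)|%:R <= 2 / (1 - cos (r / 2))].
Proof.
case: d mu => [//|n] mu d2 a2 _ pab mu_min h0 hess beta C_J r.
move: pab; rewrite in_itv /= => apb.
(* [C_J] and [hoelder_const b] agree by unfolding, so [erefl r] identifies the radii. *)
have sep := supp_separated a2 apb mu_min h0 hess (erefl r).
have r01 : 0 < r <= 1.
  rewrite ge_min lexx andbT lt_min ltr01 powR_gt0// divr_gt0// mulr_gt0//.
  by apply: hoelder_const_gt0; case/andP: apb; lra.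
have vol (B : {fset sphere R n}) : [set` B] `<=` supp mu ->
    #|` B|%:R <= (1 + pi / r) ^+ n.+1.
  by move=> /(fset_enum_sep sep)[c]; exact: volume_count.
(* Finiteness comes first: on an infinite set [fset_set] would be the empty default. *)
have fin := bounded_finite_set vol.
have supp_sub : [set` fset_set (supp mu)] `<=` supp mu by rewrite fset_setK.
split=> //; first exact: vol.
by move=> [n2]; have [c /(cap_count r01)] := fset_enum_sep sep supp_sub; exact.
Qed.
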